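(* Let $L$ be an even elementary lattice of level $N$ and let $F:\mathbb{H}\to\mathbb{C}[L^*/L]$ be a holomorphic function, invariant under $\mathrm{Aut}(L^*/L)$, with $F(g\tau)=\phi(\tau)^{2k}\rho_L(g)F(\tau)$ for all $g=(M,\phi)\in\mathrm{Mp}_2(\mathbb{Z})$ (poles at the cusp allowed). Then there is a scalar function $f$, which is a linear combination of the components $F_\gamma$ of $F$ with $\gamma^2/2\equiv0\pmod1$, satisfying $f|_h=\chi_L(h)f$ for $h\in\tilde\Gamma_0(N)$, such that $F(\tau)=\sum_{g\in\tilde\Gamma_0(N)\backslash\mathrm{Mp}_2(\mathbb{Z})}f|_g(\tau)\rho_L(g^{-1})e_0$.
   Context: $\mathrm{Mp}_2(\mathbb{Z})$ is the group of pairs $(M,\phi)$, $M=\begin{pmatrix}a&b\\c&d\end{pmatrix}\in\mathrm{SL}_2(\mathbb{Z})$, $\phi$ a holomorphic square root of $c\tau+d$, with product $(A,f)(B,g)=(AB,f(B\tau)g(\tau))$, generated by $T=(\begin{pmatrix}1&1\\0&1\end{pmatrix},1)$ and $S=(\begin{pmatrix}0&-1\\1&0\end{pmatrix},\sqrt\tau)$. For an even lattice $L$ of signature $(b^+,b^-)$, the Weil representation $\rho_L$ on $\mathbb{C}[L^*/L]$ (basis $e_\gamma$) is $\rho_L(T)e_\gamma=\mathbf e(\gamma^2/2)e_\gamma$, $\rho_L(S)e_\gamma=\frac{\mathbf e(-(b^+-b^-)/8)}{\sqrt{|L^*/L|}}\sum_\delta\mathbf e(-(\gamma,\delta))e_\delta$,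 $\mathbf e(x)=e^{2\pi ix}$. Level $N$: least positive integer with $N\gamma^2/2\in\mathbb{Z}$ for all $\gamma\in L^*$; $L$ elementary: $L^*/L$ annihilated by a squarefree integer. $\tilde\Gamma_0(N)$: inverse image of $\Gamma_0(N)$ in $\mathrm{Mp}_2(\mathbb{Z})$. $\chi_L$ is the character of $\tilde\Gamma_0(N)$ with $\rho_L(g)e_\delta=\chi_L(g)e_{a\delta}$ for $g=(\begin{pmatrix}a&b\\c&d\end{pmatrix},\phi)\in\tilde\Gamma_0(N)$ and all $\delta$ with $\delta^2/2\equiv0\pmod1$. Slash operator: $f|_g(\tau)=\phi(\tau)^{-2k}f(g\tau)$. $\mathrm{Aut}(L^*/L)$ (automorphisms of $L^*/L$ preserving $\gamma\mapsto\gamma^2/2\bmod1$) acts by $e_\gamma\mapsto e_{\sigma\gamma}$. *)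

(* Defs.v *)
From HB Require Import structures.
From mathcomp Require Import all_boot all_order all_algebra.
From mathcomp Require Import all_classical all_reals all_analysis.
From mathcomp Require Import complex Rstruct Rstruct_topology.
Import Order.TTheory GRing.Theory Num.Theory.
Import numFieldNormedType.Exports.

Set Implicit Arguments.
Unset Strict Implicit.
Unset Printing Implicit Defensive.

Local Open Scope ring_scope.

Definition Rr : realType := Rdefinitions.R.
Definition C : numFieldType := (Rr[i] : numFieldType).

Definition upper (z : C) : Prop := 0 < complex.Im (z : Rr[i]).

(** holomorphic on the upper half plane: complex differentiable at every
    point of H (derivative in the complex normed space C over itself) *)
Definition holoH (f : C -> C) : Prop := forall z, upper z -> derivable f z 1.

Definition eC (x : rat) : C :=
  ((cos (2 * pi * ratr x) : Rr) +i* (sin (2 * pi * ratr x) : Rr))%C.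

(** * The metaplectic group Mp_2(Z)
    An element is a pair (M, phi), M = (a b; c d) in SL_2(Z), phi a holomorphic
    square root of c tau + d on H.  Functions are normalised to be 0 off H, so
    that Leibniz equality of records is equality in Mp_2(Z). *)
Record mp2 := Mp2 { ma : int; mb : int; mc : int; md : int; mphi : C -> C }.

Definition mob (a b c d : int) (t : C) : C :=
  (a%:~R * t + b%:~R) / (c%:~R * t + d%:~R).

Definition act (g : mp2) (t : C) : C := mob (ma g) (mb g) (mc g) (md g) t.

Definition valid (g : mp2) : Prop :=
  [/\ ma g * md g - mb g * mc g = 1,
      holoH (mphi g),
      (forall t, upper t -> mphi g t ^+ 2 = (mc g)%:~R * t + (md g)%:~R) &
      (forall t, ~ upper t -> mphi g t = 0)].

Definition mp2mul (g h : mp2) : mp2 :=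
  Mp2 (ma g * ma h + mb g * mc h) (ma g * mb h + mb g * md h)
      (mc g * ma h + md g * mc h) (mc g * mb h + md g * md h)
      (fun t => if `[< upper t >] then mphi g (act h t) * mphi h t else 0).

Definition mp2inv (g : mp2) : mp2 :=
  Mp2 (md g) (- mb g) (- mc g) (ma g)
      (fun t => if `[< upper t >]
                then (mphi g (mob (md g) (- mb g) (- mc g) (ma g) t))^-1
                else 0).

Definition gamma0 (N : nat) (g : mp2) : Prop :=
  valid g /\ (N%:Z %| mc g)%Z.

Definition coset_reps (N m : nat) (r : 'I_m -> mp2) : Prop :=
  (forall i, valid (r i)) /\
  (forall g, valid g -> exists! i, gamma0 N (mp2mul g (mp2inv (r i)))).

(** weight-k slash operator, with k2 = 2k : f|_g(tau) = phi(tau)^{-2k} f(g tau) *)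
Definition slash (k2 : int) (f : C -> C) (g : mp2) : C -> C :=
  fun t => (mphi g t) ^ (- k2) * f (act g t).

(** * Even lattices
    L = Z^n with integral Gram matrix G (bilinear form (x,y) = x^T G y). *)
Definition is_int (x : rat) : bool := denq x == 1.

Definition GQ n (G : 'M[int]_n) : 'M[rat]_n := map_mx (fun z : int => z%:~R) G.

Definition even_lattice n (G : 'M[int]_n) : Prop :=
  [/\ G^T = G, (forall i, (2 %| G i i)%Z) & \det G != 0].

(** signature (bp, bm), via Sylvester's law of inertia *)
Definition signature n (G : 'M[int]_n) (bp bm : nat) : Prop :=
  exists P : 'M[rat]_n, exists dg : 'rV[rat]_n,
    [/\ P \in unitmx, P^T *m GQ G *m P = diag_mx dg,
        #|[set i | 0 < dg 0 i]| = bp & #|[set i | dg 0 i < 0]| = bm].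

Definition in_dual n (G : 'M[int]_n) (x : 'cV[rat]_n) : Prop :=
  forall i, is_int ((GQ G *m x) i 0).

Definition qform n (G : 'M[int]_n) (x : 'cV[rat]_n) : rat :=
  ((x^T *m GQ G *m x) 0 0) / 2.

Definition level n (G : 'M[int]_n) (N : nat) : Prop :=
  [/\ (0 < N)%N,
      (forall x, in_dual G x -> is_int (N%:R * qform G x)) &
      (forall M : nat, (0 < M)%N ->
         (forall x, in_dual G x -> is_int (M%:R * qform G x)) -> (N <= M)%N)].

Definition squarefree (m : nat) : Prop :=
  forall p, prime p -> ~~ (p * p %| m)%N.

Definition elementary n (G : 'M[int]_n) : Prop :=
  exists m : nat, [/\ (0 < m)%N, squarefree m &
    forall x, in_dual G x -> forall i, is_int (m%:R * x i 0)].

(** * The discriminant group L^*/L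
    Every class of L^*/L has a unique representative gamma in [0,1)^n, and
    then dG * gamma is integral, dG = |det G|.  We represent gamma by
    y = dG * gamma in {0..dG-1}^n, subject to G y = 0 mod dG. *)
Definition dG n (G : 'M[int]_n) : nat := `|\det G|%N.

Definition discr_pred n (G : 'M[int]_n) (y : {ffun 'I_n -> 'I_(dG G)}) : bool :=
  [forall i, ((dG G)%:Z %| \sum_j G i j * (nat_of_ord (y j))%:Z)%Z].

Definition Disc n (G : 'M[int]_n) := {y : {ffun 'I_n -> 'I_(dG G)} | @discr_pred n G y}.
HB.instance Definition _ n (G : 'M[int]_n) :=
  Finite.copy (Disc G) {y : {ffun 'I_n -> 'I_(dG G)} | @discr_pred n G y}.

Definition dvec n (G : 'M[int]_n) (y : Disc G) : 'cV[rat]_n :=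
  \col_i ((nat_of_ord (val y i))%:R / (dG G)%:R).

Definition qD n (G : 'M[int]_n) (y : Disc G) : rat := qform G (dvec y).
Definition bD n (G : 'M[int]_n) (y z : Disc G) : rat :=
  ((dvec y)^T *m GQ G *m dvec z) 0 0.

Definition isZeroD n (G : 'M[int]_n) (y : Disc G) : bool :=
  [forall i, nat_of_ord (val y i) == 0%N].

Definition addD n (G : 'M[int]_n) (y z w : Disc G) : bool :=
  [forall i, ((val y i + val z i) %% dG G)%N == nat_of_ord (val w i)].

Definition autD n (G : 'M[int]_n) (s : Disc G -> Disc G) : Prop :=
  [/\ bijective s,
      (forall y z w, addD y z w -> addD (s y) (s z) (s w)) &
      (forall y, is_int (qD (s y) - qD y))].

(** * Vectors of C[L^*/L] are functions Disc G -> C; a linear map is given by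
    its matrix rho : Disc G -> Disc G -> C (rho d g = coefficient of e_d in
    rho(e_g)). *)
Definition e0 n (G : 'M[int]_n) : Disc G -> C := fun d => if isZeroD d then 1 else 0.

Definition applyR n (G : 'M[int]_n) (A : Disc G -> Disc G -> C) (v : Disc G -> C)
  : Disc G -> C := fun d => \sum_g A d g * v g.

Definition weil_rep n (G : 'M[int]_n) (bp bm : nat)
  (rho : mp2 -> Disc G -> Disc G -> C) : Prop :=
  [/\ (forall g h, valid g -> valid h ->
         forall d e, rho (mp2mul g h) d e = \sum_b rho g d b * rho h b e),
      (forall g, valid g -> ma g = 1 -> mb g = 1 -> mc g = 0 -> md g = 1 ->
         (forall t, upper t -> mphi g t = 1) ->
         forall d e, rho g d e = if d == e then eC (qD e) else 0) &
      (forall g, valid g -> ma g = 0 -> mb g = -1 -> mc g = 1 -> md g = 0 ->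
         (forall t, upper t -> 0 < complex.Re (mphi g t : Rr[i])) ->
         forall d e, rho g d e =
           eC (- ((bp%:Z - bm%:Z)%:~R / 8)) / ((Num.sqrt (#|{: Disc G}|%:R : Rr))%:C)%C
           * eC (- bD e d))].

(** chi_L(h): the scalar with rho_L(h) e_0 = chi_L(h) e_0 (case delta = 0) *)
Definition chiL n (G : 'M[int]_n) (rho : mp2 -> Disc G -> Disc G -> C) (h : mp2) : C :=
  \sum_d e0 d * applyR (rho h) (@e0 n G) d.

(* Main.v *)
Require Import Defs.
From HB Require Import structures.
From mathcomp Require Import all_boot all_order all_algebra.
From mathcomp Require Import all_classical all_reals all_analysis.
From mathcomp Require Import complex Rstruct Rstruct_topology.
From mathcomp Require Import zify ring lra.
Import Order.TTheory GRing.Theory Num.Theory.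
Import numFieldNormedType.Exports.
Set Implicit Arguments.
Unset Strict Implicit.
Unset Printing Implicit Defensive.
Local Open Scope classical_set_scope.
Local Open Scope ring_scope.

(** Write e_0 for the vector attached to the zero class.  The vector e_0 is an
    eigenvector of Gamma_0(N)~: conjugation by rho(g) permutes the Heisenberg
    operators according to the matrix of g, and e_0 is characterised up to a
    scalar as the common fixed vector of the multiplication operators.  Hence
    the frame operator S = sum_g rho(g^-1) e_0 e_0^* rho(g), g running over
    Gamma_0(N)~\Mp_2(Z), is well defined and commutes with rho, and since rho
    is unitary e_0 is in the image of S.  So lam S = e_0^* for some functional
    lam, and lam may be taken supported on the isotropic classes because S
    commutes with rho(T).  If F = S w then f = lam F satisfies
    lam(rho(g) F) = e_0^* rho(g) w, and the required expansion of F is S w = F.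

    It remains to see that every invariant of Aut(L^*/L) is in the image of S,
    i.e. in the span of the orbit of e_0.  The image of S is stable under
    multiplication by functions of the norm of the p-component and under the
    Fourier conjugates of these multiplications, which are convolutions by
    Gauss sum kernels supported on the p-component.  Starting from e_0 one
    obtains, one prime at a time, the indicator functions of the classes given
    by the norm of each component, its vanishing, and, for p = 2, its being the
    characteristic vector.  By Witt's theorem, in the form of explicit chains
    of reflections and Eichler transformations, these classes are orbits. *)

(** * Finite quadratic modules *)

Record quadratic_module (K : numFieldType) (D : finZmodType)
    (Q : D -> K) (B : D -> D -> K) : Prop := QuadraticModule {
  quad_neq0 : forall x, Q x != 0;
  quadN : forall x, Q (- x) = Q x;
  quadD : forall x y, Q (x + y) = Q x * Q y * B x y;
  pairC : forall x y, B x y = B y x;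
  pairDl : forall x y z, B (x + y) z = B x z * B y z;
  pair_nondeg : forall x, (forall y, B x y = 1) -> x = 0
}.

Section QuadraticModule.
Variables (K : numFieldType) (D : finZmodType) (Q : D -> K) (B : D -> D -> K).
Hypothesis hQ : quadratic_module Q B.

Let Q_neq0 := quad_neq0 hQ.
Let QN := quadN hQ.
Let QD := quadD hQ.
Let BC := pairC hQ.
Let BDl := pairDl hQ.
Let nondeg := pair_nondeg hQ.

Lemma pair_neq0 x y : B x y != 0.
Proof. by have := Q_neq0 (x + y); rewrite QD mulf_eq0 negb_or => /andP[]. Qed.
Hint Resolve pair_neq0 : core.

Lemma pair0l y : B 0 y = 1.
Proof.
by apply: (mulfI (pair_neq0 0 y)); rewrite -BDl addr0 mulr1.
Qed.

Lemma pair0r y : B y 0 = 1. Proof. by rewrite BC pair0l. Qed.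

Lemma pairDr x y z : B z (x + y) = B z x * B z y.
Proof. by rewrite BC BDl !(BC z). Qed.

Lemma pairNl x y : B (- x) y = (B x y)^-1.
Proof.
apply: (mulfI (pair_neq0 x y)).
by rewrite -BDl subrr pair0l divff.
Qed.

Lemma pairNr x y : B x (- y) = (B x y)^-1.
Proof. by rewrite BC pairNl BC. Qed.

Lemma pairMnl x y n : B (x *+ n) y = B x y ^+ n.
Proof.
by elim: n => [|n IH]; rewrite ?mulr0n ?pair0l ?expr0 // mulrS exprS BDl IH.
Qed.

Lemma pairMnr x y n : B x (y *+ n) = B x y ^+ n.
Proof. by rewrite BC pairMnl BC. Qed.

Lemma quad0 : Q 0 = 1.
Proof.
apply: (mulfI (Q_neq0 0)); rewrite mulr1.
by rewrite -{3}(addr0 0) QD pair0l mulr1.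
Qed.

Lemma pair_diag x : B x x = Q x ^+ 2.
Proof.
have := QD x (- x); rewrite subrr quad0 QN pairNr => h.
by apply: (mulIf (x:=(B x x)^-1)); rewrite ?invr_eq0 // divff // expr2 -h.
Qed.

Lemma quadMn x n : Q (x *+ n) = Q x ^+ (n ^ 2).
Proof.
elim: n => [|n IH]; first by rewrite mulr0n quad0.
rewrite mulrS QD IH pairMnr pair_diag -exprS -exprM -exprD; congr (_ ^+ _).
by rewrite -!mulnn; nia.
Qed.

Lemma quadB x y : Q (x - y) = Q x * Q y / B x y.
Proof. by rewrite QD QN pairNr. Qed.

Lemma pair_torsion x y n : y *+ n = 0 -> B x y ^+ n = 1.
Proof. by move=> h; rewrite -pairMnr h pair0r. Qed.

Lemma quad_torsion2 x n : x *+ n = 0 -> Q x ^+ (2 * n) = 1.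
Proof. by move=> h; rewrite exprM -pair_diag -pairMnr h pair0r. Qed.

Lemma quad_torsion_odd x n : odd n -> x *+ n = 0 -> Q x ^+ n = 1.
Proof.
move=> on h.
have h1 := quad_torsion2 h.
have h2 : Q x ^+ (n ^ 2) = 1 by rewrite -quadMn h quad0.
have : Q x ^+ (n * n) = 1 by rewrite mulnn.
have {1}-> : n = (n./2.*2).+1 by rewrite -[LHS]odd_double_half on.
by rewrite mulSn exprD -mul2n mulnAC exprM h1 expr1n mulr1.
Qed.

Lemma pair_char2 (x w : D) : w *+ 2 = 0 -> (B x w == 1) || (B x w == -1).
Proof. by move=> h; rewrite -eqf_sqr expr1n pair_torsion. Qed.

Lemma unity_prim (p : nat) (z : K) : prime p -> z ^+ p = 1 -> z != 1 ->
  p.-primitive_root z.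
Proof.
move=> pp zp z1; have [k kp] := prim_order_exists (prime_gt0 pp) zp.
move/(primeP pp).2/orP => [] /eqP ek; subst k => //.
by move: (prim_expr_order kp); rewrite expr1 => e; rewrite e eqxx in z1.
Qed.

(** Orthogonality of characters: translating the sum by an [a] with [c a != 1] multiplies it by
    [c a], so it vanishes. The boolean factor records whether [c] is trivial. *)
Lemma sum_character (c : D -> K) :
  (forall x y, c (x + y) = c x * c y) -> c 0 = 1 ->
  \sum_x c x = (#|D| * [forall x, c x == 1])%:R.
Proof.
move=> cD c0; case: forallP => [h|/forallP]; last first.
  case/forallPn => a ca; rewrite muln0.
  have e : \sum_x c x = c a * \sum_x c x.
    rewrite mulr_sumr (reindex_inj (addrI a)) /=.
    by apply: eq_bigr => x _; rewrite cD.
  move/eqP: e; rewrite -subr_eq0 -{1}[\sum_x _]mul1r -mulrBl mulf_eq0.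
  by rewrite subr_eq0 eq_sym (negPf ca) => /eqP.
rewrite muln1 (eq_bigr (fun=> 1)) => [|x _]; last exact/eqP.
by rewrite sumr_const.
Qed.

Lemma sum_pair x : \sum_y B y x = (#|D| * (x == 0))%:R.
Proof.
rewrite (sum_character (c := B ^~ x)) ?pair0l //.
congr (_ * _)%:R; congr nat_of_bool; apply/forallP/eqP => [h|-> y].
  by apply: nondeg => y; rewrite BC; apply/eqP.
by rewrite pair0r.
Qed.

Definition quad_invariant (F : D -> K) : Prop :=
  forall s : D -> D, (forall x y, s (x + y) = s x + s y) ->
  (forall x, Q (s x) = Q x) -> forall x, F (s x) = F x.

(** An isometry preserves [B], which is determined by [Q], so its kernel is orthogonal to
    everything. On the finite set [D] isometries are thus bijective, and [quad_invariant] means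
    invariance under the orthogonal group. *)
Lemma isometry_inj (s : D -> D) : (forall x y, s (x + y) = s x + s y) ->
  (forall x, Q (s x) = Q x) -> injective s.
Proof.
move=> sD sQ.
have sB x y : B (s x) (s y) = B x y.
  apply: (mulfI (mulf_neq0 (Q_neq0 x) (Q_neq0 y))).
  by rewrite -[RHS]QD -[RHS]sQ sD QD !sQ.
have s0 : s 0 = 0 by apply: (addrI (s 0)); rewrite -sD !addr0.
move=> x y e; apply/eqP; rewrite -subr_eq0; apply/eqP/nondeg => z.
rewrite -sB sD e -sD subrr s0; exact: pair0l.
Qed.

(** * Witt's theorem on one primary component *)

Section Witt.
Variable F : D -> K.
Hypothesis hF : quad_invariant F.

(** The reflection in [z = x - y] sends [g] to [g - z *+ k] with [B g z = Q z ^+ k]; primitivity of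
    [Q z] makes [k] well defined modulo [p]. Equal norms force [B x z = Q z], so [x] goes to [y]. *)
Lemma reflection_invariant (p : nat) x y : (x - y) *+ p = 0 -> Q x = Q y ->
  p.-primitive_root (Q (x - y)) -> F x = F y.
Proof.
set z := x - y => pz hxy prz.
have p_gt0 := prim_order_gt0 prz.
have kP g : {i : 'I_p | B g z = Q z ^+ i}.
  by apply: (prim_rootP prz); apply: pair_torsion.
pose k g : nat := sval (kP g).
have kE g : B g z = Q z ^+ k g by rewrite /k; case: (kP g).
have zmod i j : (i = j %[mod p])%N -> z *+ i = z *+ j.
  move=> e; rewrite (divn_eq i p) (divn_eq j p) e !mulrnDr !(mulnC _ p).
  by rewrite !mulrnA pz !mul0rn.
pose s g := g - z *+ k g.
have sx : s x = y.
  suff -> : s x = x - z by rewrite /z opprB addrC subrK.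
  rewrite /s; congr (_ - _); rewrite -[RHS]mulr1n; apply: zmod; apply/eqP.
  rewrite -(eq_prim_root_expr prz) -kE expr1.
  have := hxy; rewrite (_ : y = x - z); last by rewrite /z opprB addrC subrK.
  rewrite quadB -mulrA -{1}[Q x]mulr1 => /(mulfI (Q_neq0 x)) e.
  by apply/eqP; rewrite -[LHS]mul1r e mulfVK.
rewrite -sx (hF (s := s)) // => [g h|g].
  rewrite /s addrACA -opprD -mulrnDr; congr (_ - _); apply: zmod; apply/eqP.
  by rewrite -(eq_prim_root_expr prz) exprD -!kE BDl.
rewrite /s quadB quadMn pairMnr kE -exprM mulnn mulfK //.
by rewrite expf_neq0.
Qed.

Lemma torsion_primitive_odd (p : nat) x : prime p -> odd p -> x *+ p = 0 ->
  Q x != 1 -> p.-primitive_root (Q x).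
Proof. by move=> pp op px; apply: unity_prim => //; apply: quad_torsion_odd. Qed.

Section LocalPart.
Variables (p e : nat).
Hypotheses (pp : prime p) (e1 : (e = 1 %[mod p])%N).
Hypothesis ep : forall x : D, x *+ e *+ p = 0.

(** Together with [ep] this makes multiplication by [e] the projection of [D] onto its
    [p]-torsion. *)
Lemma part_id (x : D) : x *+ p = 0 -> x *+ e = x.
Proof.
move=> px; rewrite (divn_eq e p) e1 (modn_small (prime_gt1 pp)) mulrnDr mulnC.
by rewrite mulrnA px mul0rn add0r.
Qed.

(** A witness [a] found in [D] can be projected to the [p]-torsion, since [B (a *+ e) x] is
    [B a (x *+ e)] and [x *+ e = x]. *)
Lemma local_nondeg (x : D) : x *+ p = 0 -> x != 0 ->
  exists2 a, a *+ p = 0 & B a x != 1.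
Proof.
move=> px x0; have [h|] := boolP [forall a, B a x == 1].
  by case/eqP: x0; apply: nondeg => y; rewrite BC; apply/eqP/(forallP h).
case/forallPn => a ha; exists (a *+ e) => //.
by rewrite pairMnl -pairMnr part_id.
Qed.

Variable w : D.
Hypothesis perp : forall z : D, z *+ p = 0 -> B w z = 1.

Let quad_wD (x : D) : x *+ p = 0 -> Q (w + x) = Q w * Q x.
Proof. by move=> px; rewrite QD perp // mulr1. Qed.

Let subw (x y : D) : (w + x) - (w + y) = x - y.
Proof. by rewrite opprD addrACA subrr add0r. Qed.

Lemma witt_link (x y : D) : odd p -> x *+ p = 0 -> y *+ p = 0 -> Q x = Q y ->
  Q (x - y) != 1 -> F (w + x) = F (w + y).
Proof.
move=> op px py hxy h; apply: (@reflection_invariant p).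
- by rewrite subw mulrnBl px py subrr.
- by rewrite !quad_wD // hxy.
- by rewrite subw; apply: torsion_primitive_odd => //; rewrite mulrnBl px py subrr.
Qed.

(* x and y of equal norm are linked by a chain of at most two reflections,
   through - y if they are anisotropic and through an isotropic vector
   orthogonal to neither otherwise. *)
Lemma witt_odd (x y : D) : odd p -> x *+ p = 0 -> y *+ p = 0 -> x != 0 -> y != 0 ->
  Q x = Q y -> F (w + x) = F (w + y).
Proof.
move=> op px py x0 y0 hxy.
have [h|] := eqVneq (Q (x - y)) 1; last exact: witt_link.
have Bxy : B x y = Q x ^+ 2.
  by move: h; rewrite quadB -hxy -expr2 => /(canRL (mulfVK (pair_neq0 _ _))) ->; rewrite mul1r.
(* A norm other than 1 of a [p]-torsion vector has exact order [p], which is odd and so does not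
   divide 4. *)
have Q4 u : u *+ p = 0 -> Q u != 1 -> Q u ^+ 4 != 1.
  move=> pu; apply: contraNneq => h4.
  have := quad_torsion_odd op pu.
  have prim := torsion_primitive_odd pp op pu.
  have [//|/prim pr _] := eqVneq (Q u) 1.
  have := prim_order_dvd pr 4; rewrite h4 eqxx.
  rewrite (_ : 4 = 2 ^ 2)%N // Euclid_dvdX // andbT dvdn_prime2 // => /eqP e2.
  by rewrite e2 in op.
(* In the anisotropic case pass through [- y]: both differences, [x + y] and [- y - y], have norm
   [Q x ^+ 4]. *)
have [hx|hx] := eqVneq (Q x) 1; last first.
  have pny : - y *+ p = 0 by rewrite mulNrn py oppr0.
  transitivity (F (w - y)); apply: witt_link; rewrite ?QN //.
    by rewrite opprK QD Bxy -hxy -expr2 -exprD; apply: Q4.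
  rewrite -opprD QN QD pair_diag -hxy -expr2 -exprD; exact: Q4.
have [a pa hax] := local_nondeg px x0.
have [b pb hby] := local_nondeg py y0.
(* One of [a], [b] and [a + b] pairs nontrivially with both [x] and [y]. *)
have [c pc /andP[hcx hcy]] :
    exists2 c, c *+ p = 0 & (B c x != 1) && (B c y != 1).
  have [hay|hay] := eqVneq (B a y) 1; last by exists a => //; rewrite hax.
  have [hbx|hbx] := eqVneq (B b x) 1; last by exists b => //; rewrite hbx.
  exists (a + b); first by rewrite mulrnDl pa pb addr0.
  by rewrite !BDl hay hbx mul1r mulr1 hax.
have pr : p.-primitive_root (B c x) by apply: unity_prim => //; apply: pair_torsion.
have [t ht] : {i : 'I_p | (Q c)^-1 = B c x ^+ i}.
  by apply: (prim_rootP pr); rewrite exprVn quad_torsion_odd ?invr1.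
(* The shift along the isotropic [x] is chosen to cancel [Q c]. It leaves the pairings with [x] and
   [y] unchanged because [B x x] and [B x y] are both 1. *)
pose z := c + x *+ t.
have pz : z *+ p = 0 by rewrite mulrnDl pc mulrnAC px mul0rn addr0.
have Qz : Q z = 1.
  by rewrite QD quadMn hx expr1n mulr1 pairMnr -ht divff.
have Bzx : B z x = B c x by rewrite BDl pairMnl pair_diag hx !expr1n mulr1.
have Bzy : B z y = B c y by rewrite BDl pairMnl Bxy hx !expr1n mulr1.
transitivity (F (w + z)); apply: witt_link; rewrite ?Qz -?hxy ?hx //.
  by rewrite quadB Qz hx !mul1r invr_eq1 BC Bzx.
by rewrite quadB Qz -hxy hx !mul1r invr_eq1 Bzy.
Qed.

End LocalPart.

(** Pairings with 2-torsion are signs, so the bit [B g a != 1] is additive modulo 2 in [g], and [b]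
    has order dividing 2. *)
Lemma bit_mulD (a b g h : D) : a *+ 2 = 0 -> b *+ 2 = 0 ->
  b *+ (B (g + h) a != 1) = b *+ (B g a != 1) + b *+ (B h a != 1).
Proof.
move=> a2 b2; rewrite BDl.
case/orP: (pair_char2 g a2) => /eqP ->; case/orP: (pair_char2 h a2) => /eqP ->;
  by rewrite ?mul1r ?mulr1 ?mulrNN ?mulr1 ?eqxx ?eqNr ?oner_eq0 ?addr0 ?add0r.
Qed.

Lemma sum_swap4 (V : zmodType) (a b c d a' b' c' d' : V) :
  (a + a') + (b + b') + (c + c') + (d + d') = (a + b + c + d) + (a' + b' + c' + d').
Proof. by rewrite -[RHS]addrACA -[X in _ = X + _]addrACA -[X in _ = X + _ + _]addrACA. Qed.

(* Eichler transformation attached to the isotropic vector u and to v. *)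
Lemma eichler_invariant (u v x : D) : u *+ 2 = 0 -> v *+ 2 = 0 -> Q u = 1 ->
  Q v ^+ 2 = 1 -> B v u = 1 -> B x u = 1 -> B x v = -1 -> F x = F (x + u).
Proof.
move=> u2 v2 Qu Qv2 Bvu Bxu Bxv.
(* The last summand corrects the norm when [Q v = -1]: it contributes the sign [B v u]-free pairing
   of [u] with [g], which cancels [Q v]. *)
pose s g := g + v *+ (B g u != 1) + u *+ (B g v != 1) +
            u *+ (Q v != 1) *+ (B g u != 1).
have sx : s x = x + u.
  by rewrite /s Bxu Bxv eqxx eqNr oner_eq0 /= !mulr0n mulr1n !addr0.
rewrite -sx (hF (s := s)) // => [g h|g].
  rewrite /s !bit_mulD //; last by rewrite mulrnAC u2 mul0rn.
  exact: sum_swap4.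
rewrite /s -mulrnA -!addrA -mulrnDr QD QD pairDr !quadMn !pairMnr !pairMnl Qu Bvu.
rewrite !expr1n !mulr1.
have Qv : (Q v == 1) || (Q v == -1) by rewrite -eqf_sqr expr1n Qv2.
have e1N : (-1 == 1 :> K) = false by rewrite eqNr oner_eq0.
case/orP: (pair_char2 g u2) => /eqP ->; case/orP: (pair_char2 g v2) => /eqP ->;
  by case/orP: Qv => /eqP ->; rewrite ?eqxx ?e1N /= ?expn1 ?exp0n //; ring.
Qed.

(** As [Q y ^+ 2] is [B y y], such an [x] represents the map sending [g] to the self-pairing of its
    component [g *+ e]. Nondegeneracy makes [x] unique, so every isometry fixes it and it is an
    orbit by itself. *)
Definition characteristic (e : nat) (x : D) := [forall g, Q (g *+ e) ^+ 2 == B g x].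

Section TwoPart.
Variable (e : nat).
Hypothesis e1 : odd e.
Hypothesis e2 : forall x : D, x *+ e *+ 2 = 0.

Let e1' : (e = 1 %[mod 2])%N. Proof. by rewrite !modn2 e1. Qed.

Let part2 x : x *+ 2 = 0 -> x *+ e = x := part_id (isT : prime 2) e1' (x := x).

(** The cross term is a pairing of 2-torsion vectors and squares to 1, so the squared norm of the
    2-component is a character. *)
Lemma quad_part2D (x y : D) :
  Q ((x + y) *+ e) ^+ 2 = Q (x *+ e) ^+ 2 * Q (y *+ e) ^+ 2.
Proof.
by rewrite mulrnDl QD !exprMn (pair_torsion _ (e2 y)) mulr1.
Qed.

Lemma quad_part2_sign (x : D) : (Q (x *+ e) ^+ 2) ^+ 2 = 1.
Proof. by rewrite -exprM; apply: (quad_torsion2 (e2 x)). Qed.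

(** Sum [(1 - B g x) * (1 - B g y) * (1 + c g)] over [g], a function supported on the vectors
    sought. The four characters with a minus sign in the expansion are nontrivial, because [x] and
    [y] are nonzero and not characteristic, and drop out. The others have nonnegative sums and the
    constant 1 a positive one, so a suitable [g] exists; its 2-component is the answer. *)
Lemma eichler_vector (x y : D) : x *+ 2 = 0 -> y *+ 2 = 0 -> x != 0 -> y != 0 ->
  ~~ characteristic e x -> ~~ characteristic e y ->
  exists v, [/\ v *+ 2 = 0, Q v ^+ 2 = 1, B v x = -1 & B v y = -1].
Proof.
move=> x2 y2 x0 y0 cx cy.
pose c g := Q (g *+ e) ^+ 2.
have cD g h : c (g + h) = c g * c h by apply: quad_part2D.
have c0 : c 0 = 1 by rewrite /c mul0rn quad0 expr1n.
have [/existsP[g]|] := boolP [exists g, (B g x != 1) && (B g y != 1) && (c g != -1)].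
  case/andP=> /andP[gx gy] gc; exists (g *+ e); rewrite e2 !pairMnl -!pairMnr (part2 x2) (part2 y2).
  have gc' : (c g == 1) || (c g == -1).
    by rewrite -eqf_sqr expr1n; apply/eqP/quad_part2_sign.
  rewrite (negPf gc) orbF in gc'.
  have := pair_char2 g x2; have := pair_char2 g y2.
  by rewrite (negPf gx) (negPf gy) => /eqP -> /eqP ->; by split=> //; apply: (eqP gc').
move/existsPn => h.
have : \sum_g (1 - B g x) * (1 - B g y) * (1 + c g) = 0.
  apply: big1 => g _; have := h g; rewrite !negb_and !negbK -orbA.
  by case/or3P => /eqP ->; rewrite ?subrr ?mul0r ?mulr0 ?mul0r.
have sum0 (d : D -> K) : (forall g h, d (g + h) = d g * d h) -> d 0 = 1 ->
   ~~ [forall g, d g == 1] -> \sum_g d g = 0.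
  by move=> dD d0 /negPf hd; rewrite sum_character // hd muln0.
have sumge0 (d : D -> K) : (forall g h, d (g + h) = d g * d h) -> d 0 = 1 ->
   0 <= \sum_g d g.
  by move=> dD d0; rewrite sum_character // ler0n.
have nc z : z *+ 2 = 0 -> ~~ characteristic e z -> ~~ [forall g, B g z * c g == 1].
  move=> z2; apply: contra => /forallP hz; apply/forallP => g; apply/eqP.
  have /eqP e3 := hz g; apply: (mulfI (pair_neq0 g z)).
  by rewrite e3 -expr2 pair_torsion.
have ntriv z : z != 0 -> ~~ [forall g, B g z == 1].
  by apply: contra => /forallP hz; apply/eqP/nondeg => g; rewrite BC; apply/eqP.
rewrite (eq_bigr (fun g => 1 + B g x * B g y + c g + B g x * B g y * c g
    - B g x - B g y - B g x * c g - B g y * c g)); last by move=> g _; ring.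
have sB z : z != 0 -> \sum_g B g z = 0.
  by move=> z0; apply: sum0 (ntriv z z0); [move=> g k; rewrite BDl | rewrite pair0l].
have sBc z : z *+ 2 = 0 -> ~~ characteristic e z -> \sum_g B g z * c g = 0.
  move=> z2 cz; apply: sum0 (nc z z2 cz); last by rewrite pair0l c0 mulr1.
  by move=> g k; rewrite BDl cD; ring.
rewrite !sumrB !big_split /= !sB // !sBc // !subr0.
have pos : 0 < \sum_(g : D) (1 : K).
  by rewrite sumr_const ltr0n; apply/card_gt0P; exists 0.
have := sumge0 (fun g => B g x * B g y); have := sumge0 c.
have := sumge0 (fun g => B g x * B g y * c g).
rewrite !pair0l c0 !mulr1 => h1 h2 h3 /eqP; rewrite gt_eqF //.
rewrite ltr_wpDr ?h1 //; first by move=> g k; rewrite !BDl cD; ring.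
rewrite ltr_wpDr ?h2 // ltr_wpDr ?h3 // => g k; rewrite !BDl; ring.
Qed.

Variable w : D.
Hypothesis perp : forall z : D, z *+ 2 = 0 -> B w z = 1.

(** The norm of [x - y] is a sign. If it is -1, the reflection in [x - y] works; if it is 1, the
    Eichler transformation with [u = x - y] and [v] from [eichler_vector] adds [x - y] to [w + x],
    giving [w + y] because [x] and [y] have order 2. *)
Lemma witt_two (x y : D) : x *+ 2 = 0 -> y *+ 2 = 0 -> x != 0 -> y != 0 ->
  ~~ characteristic e x -> ~~ characteristic e y ->
  Q x = Q y -> F (w + x) = F (w + y).
Proof.
move=> x2 y2 x0 y0 cx cy hxy.
have u2 : (x - y) *+ 2 = 0 by rewrite mulrnBl x2 y2 subrr.
have eu : (w + x) - (w + y) = x - y by rewrite opprD addrACA subrr add0r.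
have [h|h] := eqVneq (Q (x - y)) 1; last first.
  apply: (@reflection_invariant 2); rewrite ?eu //.
    by rewrite !QD !perp ?hxy.
  apply: unity_prim => //; rewrite quadB -hxy -expr2 exprMn exprVn.
  by rewrite pair_torsion // invr1 mulr1 -pair_diag pair_torsion.
have [v [v2 Qv vx vy]] := eichler_vector x2 y2 x0 y0 cx cy.
have yN : y = - y by apply/eqP; rewrite -addr_eq0 -mulr2n y2.
rewrite (_ : w + y = w + x + (x - y)); last first.
  by rewrite -addrA (addrA x x) -mulr2n x2 add0r -yN.
apply: (eichler_invariant (v := v)) => //.
- by rewrite pairDr pairNr vx vy invrN1 mulrNN mulr1.
- rewrite BDl perp // mul1r pairDr pairNr pair_diag -{1}h quadB -hxy.
  by rewrite -expr2.
- by rewrite BDl perp // mul1r BC.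
Qed.

End TwoPart.
End Witt.

(** * Decomposition into primary components and orbit invariants *)

Section Squarefree.
Variable m : nat.
Hypotheses (m_gt0 : (0 < m)%N) (sqf : forall p, prime p -> ~~ (p * p %| m)%N).
Hypothesis killed : forall x : D, x *+ m = 0.

(** The idempotent of Z/m whose multiplication projects [D] onto its [p]-component. *)
Definition idem (p : nat) : nat := chinese p (m %/ p) 1 0.

Lemma mulrn_dvd (x : D) k : (m %| k)%N -> x *+ k = 0.
Proof. by case/dvdnP=> q ->; rewrite mulnC mulrnA killed mul0rn. Qed.

Section Idem.
Variable p : nat.
Hypothesis pm : p \in primes m.

Lemma idem_prime : prime p. Proof. by move: pm; rewrite mem_primes => /and3P[]. Qed.
Lemma idem_dvdn : (p %| m)%N. Proof. by move: pm; rewrite mem_primes => /and3P[]. Qed.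

Let cop : coprime p (m %/ p).
Proof.
rewrite prime_coprime ?idem_prime //; apply: contra (sqf idem_prime) => h.
by rewrite -(divnK idem_dvdn) dvdn_mul.
Qed.

Lemma idem_mod1 : (idem p = 1 %[mod p])%N.
Proof. exact: chinese_modl. Qed.

Lemma dvdn_idem : (m %/ p %| idem p)%N.
Proof. by rewrite /dvdn (chinese_modr cop) mod0n. Qed.

Lemma idem_ndvd : ~~ (p %| idem p)%N.
Proof. by rewrite /dvdn idem_mod1 modn_small // prime_gt1 ?idem_prime. Qed.

Lemma idem_torsion (x : D) : x *+ idem p *+ p = 0.
Proof.
by rewrite -mulrnA mulrn_dvd // -{1}(divnK idem_dvdn) dvdn_mul ?dvdn_idem.
Qed.

End Idem.

Lemma idem_orth (p q : nat) (x : D) : p \in primes m -> q \in primes m -> p != q ->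
  x *+ idem p *+ idem q = 0.
Proof.
move=> pm qm npq; rewrite -mulrnA mulrn_dvd // -{1}(divnK (idem_dvdn pm)).
apply: dvdn_mul; first exact: dvdn_idem.
apply: dvdn_trans (dvdn_idem qm).
have := idem_dvdn pm; rewrite -{1}(divnK (idem_dvdn qm)) Gauss_dvdl //.
by rewrite prime_coprime ?idem_prime // dvdn_prime2 ?idem_prime.
Qed.

Lemma idem_idem (p : nat) (x : D) : p \in primes m ->
  x *+ idem p *+ idem p = x *+ idem p.
Proof.
by move=> pm; apply: (part_id (idem_prime pm) (idem_mod1 pm)); apply: idem_torsion.
Qed.

(** Descent on a divisor [k] of [m] killing [x]: for a prime [p] dividing [k], Bezout shows that the
    gcd of [k] and [idem p] also kills [x], and it is smaller than [k] because [p] does not divide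
    [idem p]. *)
Lemma idem_eq0 (x : D) : (forall p, p \in primes m -> x *+ idem p = 0) -> x = 0.
Proof.
move=> hx; have : x *+ m = 0 by [].
have : (m %| m)%N by []; move: {1 3}m => k.
elim/ltn_ind: k => k IH km xk.
have k_gt0 : (0 < k)%N := dvdn_gt0 m_gt0 km.
have [k1|k1] := leqP k 1.
  by have := xk; rewrite (_ : k = 1)%N ?mulr1n //; apply/eqP; rewrite eqn_leq k1.
have pk := pdiv_dvd k; have pp := pdiv_prime k1.
have pm : pdiv k \in primes m by rewrite mem_primes pp m_gt0 (dvdn_trans pk).
have gk := dvdn_gcdl k (idem (pdiv k)).
apply: (IH (gcdn k (idem (pdiv k)))).
- rewrite ltn_neqAle dvdn_leq // andbT.
  apply: contraNneq (idem_ndvd pm) => e.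
  by apply: dvdn_trans pk _; rewrite -{1}e dvdn_gcdr.
- exact: dvdn_trans km.
- have [a _ /dvdnP[b e]] := Bezoutl (idem (pdiv k)) k_gt0.
  have : x *+ (b * k) = 0 by rewrite mulnC mulrnA xk mul0rn.
  by rewrite -e mulrnDr (mulnC a) mulrnA hx // mul0rn addr0.
Qed.

(** Orbit invariant of the [p]-component. Vanishing is recorded because 0 shares its norm with the
    nonzero isotropic vectors, and the last flag because the characteristic vector is fixed by all
    isometries. *)
Definition part_class (p : nat) (x : D) : K * bool * bool :=
  let y := x *+ idem p in (Q y, y == 0, (p == 2)%N && characteristic (idem p) y).

Definition quad_class (x : D) := [seq part_class p x | p <- primes m].

(** The common part away from [p] serves as the [w] of the Witt lemmas. Two characteristic
    components coincide by nondegeneracy; other nonzero ones are handled by [witt_odd] or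
    [witt_two]. *)
Lemma part_invariant F (p : nat) x y : quad_invariant F -> p \in primes m ->
  x - x *+ idem p = y - y *+ idem p -> part_class p x = part_class p y -> F x = F y.
Proof.
move=> hF pm exy; case=> hq h0 hc.
have pp := idem_prime pm; have e1 := idem_mod1 pm.
rewrite -[x](subrK (x *+ idem p)) -[y](subrK (y *+ idem p)) exy.
have tx := idem_torsion pm x; have ty := idem_torsion pm y.
have perp z : z *+ p = 0 -> B (y - y *+ idem p) z = 1.
  by move=> pz; rewrite BDl pairNl pairMnl -pairMnr (part_id pp e1 pz) divff.
have [x0|x0] := eqVneq (x *+ idem p) 0.
  by move: h0; rewrite x0 eqxx => /esym/eqP ->.
have y0 : y *+ idem p != 0 by rewrite -h0.
have [op|] := boolP (odd p).
  exact: (witt_odd hF pp e1 (idem_torsion pm) perp op).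
case: (even_prime pp) => [p2 _|-> //]; subst p.
have oe : odd (idem 2) by move: e1; rewrite !modn2; case: odd.
case: (boolP (characteristic _ _)) hc => cx /= hc.
  congr (F (_ + _)); apply/eqP; rewrite -subr_eq0; apply/eqP/nondeg => g.
  rewrite BC pairDr pairNr -(eqP (forallP cx g)).
  by rewrite -(eqP (forallP (esym hc) g)) divff // expf_neq0.
by apply: (witt_two hF oe (idem_torsion pm) perp) => //; rewrite -hc.
Qed.

Lemma class_invariant F x y : quad_invariant F -> quad_class x = quad_class y ->
  F x = F y.
Proof.
move=> hF hxy.
(* [z s] has the components of [y] at the primes in [s] and those of [x] elsewhere, so [x] is
   changed into [y] one prime at a time. *)
pose z (s : seq nat) := x + \sum_(p <- s) (y - x) *+ idem p.
have zp s p : uniq s -> {subset s <= primes m} -> p \in primes m ->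
    z s *+ idem p = (if p \in s then y else x) *+ idem p.
  move=> us ss pm; rewrite mulrnDl -sumrMnl.
  case: ifP => ps.
    rewrite (bigD1_seq p) //= idem_idem // big_seq_cond big1 ?addr0.
      by rewrite -mulrnDl addrC subrK.
    by move=> q /andP[/ss qm npq]; rewrite idem_orth.
  rewrite big_seq_cond big1 ?addr0 // => q /andP[qs _].
  by apply: idem_orth; [exact: ss | exact: pm | apply/eqP => e; rewrite e ps in qs].
have Fz s : uniq s -> {subset s <= primes m} -> F (z s) = F x.
  elim: s => [|p s IH]; first by rewrite /z big_nil addr0.
  move=> us ss; have /andP[nps us'] := us.
  have ss' : {subset s <= primes m} by move=> q qs; apply: ss; rewrite inE qs orbT.
  have pm : p \in primes m by apply: ss; rewrite inE eqxx.
  rewrite -(IH us' ss'); apply: (part_invariant hF pm).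
    rewrite !zp // inE eqxx (negPf nps) /z big_cons /= addrCA mulrnBl.
    by rewrite addrAC [_ - _ - _]addrAC subrr add0r addrC.
  rewrite /part_class !zp // inE eqxx (negPf nps) /=.
  have := @congr1 _ _ (fun s => nth (0, false, false) s (index p (primes m))) _ _ hxy.
  by rewrite !(nth_map 0%N) ?index_mem // !nth_index //.
rewrite -(Fz (primes m)) ?primes_uniq //; congr F; apply/eqP; rewrite -subr_eq0; apply/eqP.
by apply: idem_eq0 => p pm; rewrite mulrnBl zp ?primes_uniq // pm subrr.
Qed.

(** * Invariant functions generated from the delta function at 0 *)

Section Closure.
Variable V : (D -> K) -> Prop.
Hypothesis V_ext : forall v v', v =1 v' -> V v -> V v'.
Hypothesis V_lin : forall a v v', V v -> V v' -> V (fun x => a * v x + v' x).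
Hypothesis V_quad : forall v, V v -> V (fun x => Q x * v x).
Hypothesis V_fourier : forall v, V v -> V (fun d => \sum_e B e d * v e).
Hypothesis V_fourierN : forall v, V v -> V (fun d => \sum_e (B e d)^-1 * v e).
Hypothesis V_delta : V (fun x => (x == 0)%:R).

Lemma closure0 : V (fun=> 0).
Proof.
apply: V_ext (V_lin (-1) V_delta V_delta) => x.
by rewrite mulN1r addNr.
Qed.

Lemma closureZ a v : V v -> V (fun x => a * v x).
Proof. by move=> hv; apply: V_ext (V_lin a hv closure0) => x; rewrite addr0. Qed.

Lemma closureB v v' : V v -> V v' -> V (fun x => v x - v' x).
Proof.
by move=> hv hv'; apply: V_ext (V_lin (-1) hv' hv) => x; rewrite mulN1r addrC.
Qed.

Lemma closure_sum (I : Type) (s : seq I) (f : I -> D -> K) :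
  (forall i, V (f i)) -> V (fun x => \sum_(i <- s) f i x).
Proof.
move=> hf; elim: s => [|i s IH].
  by apply: V_ext closure0 => x; rewrite big_nil.
by apply: V_ext (V_lin 1 (hf i) IH) => x; rewrite big_cons mul1r.
Qed.

Lemma closure_quadX k v : V v -> V (fun x => Q x ^+ k * v x).
Proof.
move=> hv; elim: k => [|k IH]; first by apply: V_ext hv => x; rewrite mul1r.
by apply: V_ext (V_quad IH) => x; rewrite exprS mulrA.
Qed.

Lemma closure_quadMn n k v : V v -> V (fun x => Q (x *+ n) ^+ k * v x).
Proof.
move=> hv; apply: V_ext (closure_quadX (n ^ 2 * k) hv) => x.
by rewrite quadMn exprM.
Qed.

Lemma closure_quad_level n z v : V v -> V (fun x => (Q (x *+ n) == z)%:R * v x).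
Proof.
move=> hv.
have poly (p : {poly K}) : V (fun x => p.[Q (x *+ n)] * v x).
  elim/poly_ind: p => [|p c IH].
    by apply: V_ext closure0 => x; rewrite horner0 mul0r.
  have IH1 : V (fun x => Q (x *+ n) * (p.[Q (x *+ n)] * v x)).
    by apply: V_ext (closure_quadMn n 1 IH) => x.
  apply: V_ext (V_lin c hv IH1) => x.
  by rewrite hornerMXaddC mulrDl addrC mulrA [_ * Q _]mulrC.
(* This polynomial vanishes at every value of [Q] other than [z]; divided by [p.[z]] it is the
   indicator of [z] on the finite set of norms. *)
pose p := \prod_(x : D | Q x != z) ('X - (Q x)%:P).
have pz : p.[z] != 0.
  rewrite horner_prod; apply/prodf_neq0 => x hx.
  by rewrite hornerXsubC subr_eq0 eq_sym.
apply: V_ext (closureZ (p.[z])^-1 (poly p)) => x; rewrite mulrA; congr (_ * _).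
have [->|hx] := eqVneq; first by rewrite mulVf.
by rewrite [p.[Q _]]horner_prod (bigD1 (x *+ n)) //= hornerXsubC subrr mul0r mulr0.
Qed.

(* The Fourier conjugate of a multiplication operator is a convolution. *)
Lemma closure_convolution n k v : V v ->
  V (fun d => \sum_x v x * \sum_g Q (g *+ n) ^+ k * B g (x - d)).
Proof.
move=> hv; apply: V_ext (V_fourierN (closure_quadMn n k (V_fourier hv))) => d.
under eq_bigr => g _ do rewrite mulr_sumr mulr_sumr.
rewrite exchange_big; apply: eq_bigr => x _; rewrite mulr_sumr.
apply: eq_bigr => g _; rewrite pairDr pairNr [B x g]BC; ring.
Qed.

Section PartClosure.
Variable p : nat.
Hypothesis pm : p \in primes m.
Let e := idem p.

(** If [y] is not in the [p]-component, some [b] with [b *+ e = 0] has [B b y != 1]. Translating [g]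
    by [b] leaves [Q (g *+ e)] alone and multiplies the sum by [B b y]. *)
Lemma gauss_kernel_supp k (y : D) : y *+ e != y ->
  \sum_g Q (g *+ e) ^+ k * B g y = 0.
Proof.
rewrite eq_sym -subr_eq0 => hy.
have [a ha] : exists a, B a (y - y *+ e) != 1.
  have [/existsP//|/existsPn h] := boolP [exists a, B a (y - y *+ e) != 1].
  case/eqP: hy; apply: nondeg => a; rewrite BC.
  by apply/eqP; have := h a; rewrite negbK.
pose b := a - a *+ e.
have be : b *+ e = 0 by rewrite mulrnBl idem_idem // subrr.
have hb : B b y != 1.
  by rewrite /b BDl pairNl pairMnl -pairMnr -pairNr -pairDr.
set t := \sum_g _; have ht : t = B b y * t.
  rewrite {1}/t (reindex_inj (addrI b)) mulr_sumr /=; apply: eq_bigr => g _.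
  by rewrite mulrnDl be add0r BDl mulrCA.
by move/eqP: ht; rewrite -subr_eq0 -{1}[t]mul1r -mulrBl mulf_eq0 subr_eq0 eq_sym (negPf hb) => /eqP.
Qed.

(** Completing the square: substitute [g - y] for [g]. *)
Lemma gauss_kernel (y : D) : y *+ e = y ->
  \sum_g Q (g *+ e) * B g y = (Q y)^-1 * \sum_g Q (g *+ e).
Proof.
move=> ye; rewrite (reindex_inj (addIr (- y))) mulr_sumr /=; apply: eq_bigr => g _.
rewrite mulrnBl ye quadB BDl pairNl pairMnl -pairMnr ye pair_diag.
have := Q_neq0 y; have := pair_neq0 g y => h1 h2.
by field; rewrite h2 h1.
Qed.

(** If the Gauss sum were 0, the two preceding lemmas would make the whole kernel vanish; but by
    orthogonality its sum over [y] is the cardinal of [D] times [Q 0]. *)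
Lemma gauss_sum_neq0 : \sum_g Q (g *+ e) != 0.
Proof.
apply/eqP => h0.
have k0 (y : D) : \sum_g Q (g *+ e) * B g y = 0.
  have [ye|ye] := eqVneq (y *+ e) y; first by rewrite gauss_kernel // h0 mulr0.
  by rewrite -[RHS](gauss_kernel_supp 1 ye).
have : \sum_y \sum_g Q (g *+ e) * B g y = 0 by apply: big1.
rewrite exchange_big /= (bigD1 0) //= [X in _ + X]big1 => [|g g0].
  under eq_bigr => y _ do rewrite pair0l mul0rn quad0 mulr1.
  rewrite addr0 sumr_const => /eqP; rewrite pnatr_eq0 -leqn0 leqNgt.
  by case/negP; apply/card_gt0P; exists 0.
rewrite -mulr_sumr; under eq_bigr => y _ do rewrite BC.
by rewrite sum_pair (negPf g0) muln0 mulr0.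
Qed.

(** The kernel forces [x - d] into the [p]-component, and [x] has none, so only [x = d - d *+ e]
    survives. *)
Lemma part_supp_sum v k d : (forall x, v x != 0 -> x *+ e = 0) ->
  \sum_x v x * (\sum_g Q (g *+ e) ^+ k * B g (x - d)) =
  v (d - d *+ e) * \sum_g Q (g *+ e) ^+ k * B g (- (d *+ e)).
Proof.
move=> hv; rewrite (bigD1 (d - d *+ e)) //= [X in _ + X]big1 ?addr0 => [|x hx].
  by congr (_ * _); apply: eq_bigr => g _; rewrite addrAC subrr add0r.
have [->|/hv xe] := eqVneq (v x) 0; first by rewrite mul0r.
rewrite gauss_kernel_supp ?mulr0 // mulrnBl xe add0r.
by apply: contra hx => /eqP h; rewrite -subr_eq0 opprB addrCA -h subrr.
Qed.

(** Convolution with the Gauss kernel spreads [v] along the [p]-component up to the factor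
    [(Q (d *+ e))^-1] and the nonzero Gauss sum; multiplying by the norm and rescaling removes
    both. *)
Lemma closure_spread v : V v -> (forall x, v x != 0 -> x *+ e = 0) ->
  V (fun d => v (d - d *+ e)).
Proof.
move=> hV hv; pose t := \sum_g Q (g *+ e).
apply: V_ext (closureZ t^-1 (closure_quadMn e 1 (closure_convolution e 1 hV))) => d.
rewrite part_supp_sum //.
under eq_bigr => g _ do rewrite expr1.
rewrite gauss_kernel; last by rewrite mulNrn idem_idem.
have := Q_neq0 (d *+ e); have := gauss_sum_neq0; rewrite QN -/t => h1 h2.
by field; rewrite h1 h2.
Qed.

(** For [p = 2] the squared norm is a character, so the kernel with exponent 2 is a character sum,
    nonzero exactly when [d *+ e] is characteristic. *)
Lemma closure_spread_char v : p = 2%N -> V v -> (forall x, v x != 0 -> x *+ e = 0) ->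
  V (fun d => (characteristic e (d *+ e))%:R * v (d - d *+ e)).
Proof.
move=> p2 hV hv; pose t : K := (#|D|)%:R.
have t0 : t != 0 by rewrite pnatr_eq0 -lt0n; apply/card_gt0P; exists 0.
apply: V_ext (closureZ t^-1 (closure_convolution e 2 hV)) => d.
rewrite part_supp_sum // (sum_character (c := fun g => Q (g *+ e) ^+ 2 * B g _)).
- rewrite natrM -/t mulrCA mulKf; last exact: t0.
  rewrite mulrC; congr (_%:R * _); congr nat_of_bool; apply: eq_forallb => g.
  rewrite pairNr; apply/eqP/eqP => [h|->]; last by rewrite divff.
  by rewrite -[LHS](divfK (pair_neq0 g (d *+ e))) h mul1r.
- move=> x y; rewrite quad_part2D ?BDl; last first.
    by move=> z; rewrite -p2; apply: idem_torsion.
  by rewrite mulrACA.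
- by rewrite mul0rn quad0 expr1n pair0l mul1r.
Qed.

Lemma closure_class v y : V v -> (forall x, v x != 0 -> x *+ e = 0) ->
  V (fun x => (part_class p x == part_class p y)%:R * v (x - x *+ e)).
Proof.
move=> hV hv; have hs := closure_spread hV hv.
have v0E x : (x *+ e == 0)%:R * v (x - x *+ e) = v x.
  have [->|xe] := eqVneq; first by rewrite subr0 mul1r.
  rewrite mul0r; apply/esym/eqP; apply: contraNT xe => /hv ->; exact: eqxx.
pose ch x := (p == 2)%N && characteristic e (x *+ e).
have hc : V (fun x => (ch x)%:R * v (x - x *+ e)).
  rewrite /ch; have [p2|_] := eqVneq p 2%N; first exact: closure_spread_char.
  by apply: V_ext closure0 => x; rewrite mul0r.
(* On the support of [v] the component is 0, so the flag is the constant [ch 0], which may be true;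
   the function is a multiple of [v]. *)
have h0c : V (fun x => (ch x)%:R * (x *+ e == 0)%:R * v (x - x *+ e)).
  apply: V_ext (closureZ (ch 0)%:R hV) => x; rewrite -mulrA v0E.
  have [->|/hv xe] := eqVneq (v x) 0; first by rewrite !mulr0.
  by rewrite /ch xe mul0rn.
have h0 : V (fun x => (x *+ e == 0)%:R * v (x - x *+ e)).
  by apply: V_ext hV => x; rewrite v0E.
have nat2 (b c : bool) : (b == c)%:R = (if c then b%:R else 1 - b%:R) :> K.
  by case: b; case: c; rewrite ?subrr ?subr0.
have E x : (part_class p x == part_class p y)%:R =
   (Q (x *+ e) == Q (y *+ e))%:R * (((x *+ e == 0) == (y *+ e == 0))%:R
    * (ch x == ch y)%:R) :> K.
  by rewrite /part_class !xpair_eqE -/e -!mulnb !natrM mulrA.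
suff hz : V (fun x => ((x *+ e == 0) == (y *+ e == 0))%:R * (ch x == ch y)%:R
     * v (x - x *+ e)).
  apply: V_ext (closure_quad_level e (Q (y *+ e)) hz) => x.
  by rewrite E -!mulrA.
(* Inclusion and exclusion yield the four combinations of zero or not and characteristic or not. *)
have hs0 := closureB hs h0; have hsc := closureB hs hc.
have h0' := closureB h0 h0c; have hc' := closureB hc h0c.
have hh := closureB hs0 hc'.
case: (y *+ e == 0) nat2 => nat2; case: (ch y) nat2 => nat2;
 [apply: V_ext h0c|apply: V_ext h0'|apply: V_ext hc'|apply: V_ext hh] => x;
 rewrite !nat2; ring.
Qed.

End PartClosure.

Lemma closure_quad_class y :
  V (fun x => (quad_class x == quad_class y)%:R).
Proof.
(* [f s] prescribes the class of [y] at the primes in [s] and a zero component at the others. It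
   starts as the delta function at 0 and ends as the indicator of the full class. *)
pose f (s : seq nat) (x : D) : K :=
  (all (fun p => if p \in s then part_class p x == part_class p y else x *+ idem p == 0)
    (primes m))%:R.
suff hf s : uniq s -> {subset s <= primes m} -> V (f s).
  apply: V_ext (hf (primes m) (primes_uniq m) (fun x => id)) => x; rewrite /f.
  congr (_%:R); congr nat_of_bool; apply/allP/eqP => [h|/eq_in_map h p pm].
    by apply/eq_in_map => p pm; have := h p pm; rewrite pm => /eqP.
  by rewrite pm; apply/eqP/h.
elim: s => [|p s IH] us ss.
  apply: V_ext V_delta => x; rewrite /f; congr (_%:R); congr nat_of_bool.
  apply/eqP/allP => [-> p _ | h]; first by rewrite in_nil mul0rn.
  by apply: idem_eq0 => p pm; apply/eqP; have := h p pm.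
have /andP[nps us'] := us.
have ss' : {subset s <= primes m} by move=> q qs; apply: ss; rewrite inE qs orbT.
have pm : p \in primes m by apply: ss; rewrite inE eqxx.
apply: V_ext (closure_class (p := p) pm y (IH us' ss') _) => x; last first.
  rewrite /f; case: allP => [/(_ p pm) + _|_]; last by rewrite eqxx.
  by rewrite (negPf nps) => /eqP.
rewrite /f -natrM mulnb; congr (_%:R); congr nat_of_bool.
have other q : q \in primes m -> q != p -> (x - x *+ idem p) *+ idem q = x *+ idem q.
  by move=> qm nqp; rewrite mulrnBl idem_orth ?subr0 // eq_sym.
apply/andP/allP => [[/eqP hp /allP h] q qm|h].
  have := h q qm; rewrite inE; have [->|nqp] /= := eqVneq q p; first by rewrite hp eqxx.
  by rewrite /part_class other.
split; first by have := h p pm; rewrite inE eqxx.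
apply/allP => q qm; have := h q qm; rewrite inE.
have [->|nqp] /= := eqVneq q p.
  by rewrite (negPf nps) mulrnBl idem_idem // subrr.
by rewrite /part_class other.
Qed.

(** By [class_invariant], [F] is a combination of class indicators. Summing over all [y] meets each
    class [c y] times, hence the division. *)
Lemma closure_invariant F : quad_invariant F -> V F.
Proof.
move=> hF; pose c (y : D) : K := (#|[pred x | quad_class x == quad_class y]|)%:R.
have c0 y : c y != 0.
  by rewrite pnatr_eq0 -lt0n; apply/card_gt0P; exists y; rewrite inE.
apply: V_ext (closure_sum (enum D) (fun y => closureZ (F y / c y) (closure_quad_class y))) => x.
rewrite big_enum /=.
rewrite (eq_bigr (fun y => F x / c x * (quad_class y == quad_class x)%:R)) => [|y _].
  rewrite -mulr_sumr -[RHS](divfK (c0 x)); congr (_ * _).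
  rewrite -natr_sum /c -sum1_card [in RHS]big_mkcond; congr (_%:R).
have [e|_] := eqVneq (quad_class x); last by rewrite !mulr0.
by rewrite (class_invariant hF e) /c e.
Qed.

End Closure.
End Squarefree.
End QuadraticModule.

(** * The metaplectic group *)

Lemma int_complex (a : int) : a%:~R = (a%:~R +i* 0)%C :> C.
Proof. by have := rmorph_int (real_complex Rr) a; move=> <-. Qed.

Lemma affine_complex (a b : int) (x y : Rr) :
  a%:~R * ((x +i* y)%C : C) + b%:~R = ((a%:~R * x + b%:~R)%R +i* (a%:~R * y)%R)%C :> C.
Proof.
rewrite !int_complex; congr Complex => /=; lra.
Qed.

Lemma upper_neq0 (c d : int) (t : C) : upper t -> (c, d) != 0 ->
  c%:~R * t + d%:~R != 0.
Proof.
case: t => x y; rewrite /upper /= => y0; apply: contra.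
rewrite affine_complex => /eqP -[] h1 /eqP.
rewrite mulf_eq0 (gt_eqF y0) orbF intr_eq0 => /eqP c0.
by move: h1; rewrite c0 mul0r add0r => /eqP; rewrite intr_eq0 => /eqP ->.
Qed.

Lemma det_row_neq0 (a b c d : int) : a * d - b * c = 1 -> (c, d) != 0.
Proof.
move=> h; apply/eqP => -[c0 d0]; move: h; rewrite c0 d0; lia.
Qed.

Lemma upper_mob (a b c d : int) (t : C) : a * d - b * c = 1 -> upper t ->
  upper (mob a b c d t).
Proof.
move=> h ht; have := upper_neq0 ht (det_row_neq0 h).
rewrite /mob; case: t ht => x y; rewrite /upper => /= y0.
rewrite !affine_complex.
have hR : a%:~R * d%:~R - b%:~R * c%:~R = 1 :> Rr by rewrite -!intrM -intrB h.
move: (a%:~R : Rr) (b%:~R : Rr) (c%:~R : Rr) (d%:~R : Rr) hR => A B E D hR hn.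
rewrite /=.
have n0 : 0 < (E * x + D) ^+ 2 + (E * y) ^+ 2.
  rewrite lt_neqAle addr_ge0 ?sqr_ge0 // andbT eq_sym.
  by move: hn; apply: contra; rewrite paddr_eq0 ?sqr_ge0 // !sqrf_eq0 => /andP[/eqP -> /eqP ->].
rewrite (_ : _ + _ = (A * D - B * E) * y / ((E * x + D) ^+ 2 + (E * y) ^+ 2)).
  by rewrite hR mul1r divr_gt0.
by field; rewrite gt_eqF.
Qed.

(** * Holomorphy on the upper half plane and the square root *)

Lemma normc_ge_Im (z : Rr[i]) : (`|complex.Im z|%:C)%C <= `|z|.
Proof.
by rewrite normc_def lecR -sqrtr_sqr ler_wsqrtr // lerDr sqr_ge0.
Qed.

Lemma upper_ball (z w : C) : upper z ->
  `|z - w| < ((complex.Im (z : Rr[i]))%:C)%C :> C -> upper w.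
Proof.
move=> hz h; have := le_lt_trans (normc_ge_Im (z - w)) h; rewrite ltcR.
case: z hz {h} => x y; case: w => x' y' /= hz; rewrite /upper /=.
by rewrite ltr_norml => /andP[]; lra.
Qed.

Lemma near_upper (z : C) : upper z -> \forall w \near z, upper w.
Proof.
move=> hz; apply/nbhs_ballP; exists ((complex.Im (z : Rr[i]))%:C)%C => /=.
  by rewrite ltcR.
by move=> w; rewrite /ball /=; apply: upper_ball.
Qed.

Lemma holoH_ext (f g : C -> C) : (forall t, upper t -> f t = g t) -> holoH f -> holoH g.
Proof.
move=> fg hf z hz; apply: (near_eq_derivable (f := f)) (hf z hz).
by apply: filterS (near_upper hz) => w /fg.
Qed.

Lemma holoH_comp (f g : C -> C) : (forall t, upper t -> upper (g t)) ->
  holoH f -> holoH g -> holoH (f \o g).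
Proof.
move=> ug hf hg z hz; apply/derivable1_diffP; apply: differentiable_comp.
  by apply/derivable1_diffP; apply: hg.
by apply/derivable1_diffP; apply/hf/ug.
Qed.

Lemma holoHM (f g : C -> C) : holoH f -> holoH g -> holoH (fun t => f t * g t).
Proof. by move=> hf hg z hz; apply: derivableM; [exact: hf|exact: hg]. Qed.

Lemma holoHV (f : C -> C) : (forall t, upper t -> f t != 0) -> holoH f ->
  holoH (fun t => (f t)^-1).
Proof. by move=> f0 hf z hz; apply: derivableV; [exact: f0|exact: hf]. Qed.

Lemma holoH_affine (a b : C) : holoH (fun t => a * t + b).
Proof.
move=> z hz; apply: derivableD; last exact: derivable_cst.
by apply: derivableM; [exact: derivable_cst|exact: derivable_id].
Qed.

Lemma holoH_mob (a b c d : int) : a * d - b * c = 1 -> holoH (mob a b c d).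
Proof.
move=> h; apply: holoHM; first exact: holoH_affine.
apply: holoHV; last exact: holoH_affine.
by move=> t ht; apply: upper_neq0 (det_row_neq0 h).
Qed.

(** The branch with positive real part, which [weil_rep] singles out for S, extended by 0 off H as
    [valid] demands. *)
Definition upper_sqrt (t : C) : C := if `[< upper t >] then sqrtc (t : Rr[i]) else 0.

Lemma upper_sqrtE t : upper t -> upper_sqrt t = sqrtc (t : Rr[i]).
Proof. by move=> ht; rewrite /upper_sqrt asboolT. Qed.

Lemma sqr_upper_sqrt t : upper t -> upper_sqrt t ^+ 2 = t.
Proof. by move=> ht; rewrite upper_sqrtE //; apply: (sqr_sqrtc (t : Rr[i])). Qed.

Lemma Re_upper_sqrt t : upper t -> 0 < complex.Re (upper_sqrt t : Rr[i]).
Proof.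
move=> ht; rewrite upper_sqrtE //; case: t ht => a b; rewrite /upper /= => b0.
rewrite sqrtr_gt0 divr_gt0 // -ltrBlDr sub0r.
have [a0|a0] := ltP a 0; last first.
  by apply: le_lt_trans (_ : 0 < _); rewrite ?oppr_le0 // sqrtr_gt0 ltr_wpDl ?sqr_ge0 ?exprn_gt0.
rewrite -(gtr0_norm (_ : 0 < - a)) ?oppr_gt0 // -sqrtr_sqr ltr_sqrt.
  by rewrite sqrrN ltrDl exprn_gt0.
by rewrite ltr_wpDl ?sqr_ge0 ?exprn_gt0.
Qed.

Lemma upper_sqrt_sum (z w : C) : upper z -> upper w ->
  ((complex.Re (upper_sqrt z : Rr[i]))%:C)%C <= `|upper_sqrt w + upper_sqrt z| :> C.
Proof.
move=> hz hw; apply: le_trans (normc_ge_Re (upper_sqrt w + upper_sqrt z)).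
rewrite lecR; have := Re_upper_sqrt hz; have := Re_upper_sqrt hw.
case: (upper_sqrt z) => x y; case: (upper_sqrt w) => x' y' /= h1 h2.
by apply: le_trans (ler_norm _); rewrite lerDr ltW.
Qed.

Lemma upper_sqrtB (z w : C) : upper z -> upper w ->
  (upper_sqrt w - upper_sqrt z) * (upper_sqrt w + upper_sqrt z) = w - z.
Proof. by move=> hz hw; rewrite -subr_sqr !sqr_upper_sqrt. Qed.

(** By [upper_sqrtB] the difference quotient at [z] is the inverse of the sum of the two roots.
    [upper_sqrt_sum] bounds that sum away from 0, which gives continuity and then the limit. *)
Lemma holoH_sqrt : holoH upper_sqrt.
Proof.
move=> z hz; set r : C := ((complex.Re (upper_sqrt z : Rr[i]))%:C)%C.
have r0 : 0 < r by rewrite ltcR Re_upper_sqrt.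
have y0 : 0 < ((complex.Im (z : Rr[i]))%:C)%C :> C by rewrite ltcR.
have nearU : \forall h \near dnbhs (0 : C), upper (h *: (1 : C) + z).
  near=> h; apply: (upper_ball hz).
  rewrite opprD addrCA subrr addr0 normrN /GRing.scale /= mulr1.
  by near: h; apply: dnbhs0_lt.
have cvs : upper_sqrt (h *: (1 : C) + z) @[h --> dnbhs (0 : C)] --> upper_sqrt z.
  apply/cvgrPdist_lt => e e0; near=> h.
  have uh : upper (h *: (1 : C) + z) by near: h.
  have := upper_sqrt_sum hz uh.
  have hne : 0 < `|upper_sqrt (h *: (1 : C) + z) + upper_sqrt z|.
    exact: lt_le_trans r0 (upper_sqrt_sum hz uh).
  move=> hs; rewrite distrC -(ltr_pM2r hne) -normrM upper_sqrtB // addrK.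
  apply: lt_le_trans (_ : e * r <= _); last by rewrite ler_pM2l.
  rewrite /GRing.scale /= mulr1; near: h; apply: dnbhs0_lt.
  exact: mulr_gt0.
have sz0 : upper_sqrt z + upper_sqrt z != 0.
  by rewrite -normr_gt0; apply: lt_le_trans r0 (upper_sqrt_sum hz hz).
apply/cvg_ex; exists (upper_sqrt z + upper_sqrt z)^-1.
apply: cvg_trans (cvgV sz0 (cvgD cvs (cvg_cst (upper_sqrt z)))).
apply: near_eq_cvg; near=> h.
have uh : upper (h *: (1 : C) + z) by near: h.
have h0 : h != 0 by near: h; apply: nbhs_dnbhs_neq.
have hne : upper_sqrt (h *: (1 : C) + z) + upper_sqrt z != 0.
  by rewrite -normr_gt0; apply: lt_le_trans r0 (upper_sqrt_sum hz uh).
rewrite /=; apply: (mulIf hne); rewrite mulVf //.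
rewrite {1}/GRing.scale /= -mulrA upper_sqrtB // addrK /GRing.scale /= mulr1.
by rewrite mulVf.
Unshelve. all: by end_near.
Qed.

(** Connectedness of H: [phi] takes values 1 and -1 and is locally constant, so its real part along
    the segment from [z0] to [z1] is continuous and never 0, and the intermediate value theorem
    excludes a change of sign. *)
Lemma sqr1_const (phi : C -> C) : holoH phi ->
  (forall t, upper t -> phi t ^+ 2 = 1) ->
  forall z0 z1, upper z0 -> upper z1 -> phi z0 = phi z1.
Proof.
move=> hphi phi2 z0 z1 hz0 hz1.
have phi1 t : upper t -> (phi t == 1) || (phi t == -1).
  by move=> ht; rewrite -eqf_sqr expr1n phi2.
pose ga (s : Rr) : C := z0 + (s%:C)%C * (z1 - z0).
have ga_upper s : s \in `[0, 1] -> upper (ga s).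
  rewrite in_itv /= => /andP[s0 s1]; rewrite /upper /ga.
  case: z0 hz0 {ga} => x y; case: z1 hz1 => x' y'; rewrite /upper /= => hy' hy.
  rewrite mul0r addr0; have [->|sn0] := eqVneq s 0; first by rewrite mul0r addr0.
  have sp : 0 < s * y' by rewrite mulr_gt0 // lt_neqAle eq_sym sn0.
  have : 0 <= (1 - s) * y by rewrite mulr_ge0 ?subr_ge0 // ltW.
  lra.
have loc (z : C) : upper z -> \forall w \near z, phi w = phi z.
  move=> hz; have /differentiable_continuous/cvgrPdist_lt/(_ 1 ltr01) hc :
    differentiable phi z by apply/derivable1_diffP/hphi.
  near=> w; have uw : upper w by near: w; apply: near_upper.
  have hd : `|phi z - phi w| < 1 by near: w.
  have h2 : (1 < `|1 + 1 : C|) by rewrite (ger0_norm (ler0n C 2)) ltr1n.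
  case/orP: (phi1 w uw) => /eqP ew; case/orP: (phi1 z hz) => /eqP ez; rewrite ?ew ?ez //;
  move: hd; rewrite ew ez ?opprK; first by rewrite -opprD normrN => /(lt_trans h2); rewrite ltxx.
  by move/(lt_trans h2); rewrite ltxx.
pose h (s : Rr) : Rr := complex.Re (phi (ga s) : Rr[i]).
have hcont : {in `[0, 1]%classic, continuous h}.
  move=> s; rewrite inE /= => hs; apply: cvg_near_cst.
  have /nbhs_ballP[e /= e0 he] := loc _ (ga_upper s hs).
  have eR : e = ((complex.Re (e : Rr[i]))%:C)%C by rewrite RRe_real // realE ltW.
  have nR : `|z1 - z0| = ((complex.Re (`|z1 - z0| : Rr[i]))%:C)%C :> C.
    by rewrite RRe_real // normr_real.
  set n := complex.Re _ in nR.
  have n0 : 0 <= n by rewrite -lecR -nR; apply: normr_ge0.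
  have e0' : 0 < complex.Re (e : Rr[i]) by rewrite -ltcR -eR; apply: e0.
  (* Here [n] is the length of the segment; [n + 1] keeps the denominator positive when
     [z0 = z1]. *)
  apply/nbhs_ballP; exists (complex.Re (e : Rr[i]) / (n + 1)) => /=.
    by rewrite divr_gt0 // ltr_wpDl.
  move=> s'; rewrite /ball /= ltr_pdivlMr ?ltr_wpDl // => hs'.
  rewrite /h (he (ga s')) // /ball /= /ga opprD addrACA subrr add0r -mulrBl normrM.
  rewrite -rmorphB /= eR nR normc_def /= expr0n addr0 sqrtr_sqr -rmorphM ltcR.
  by apply: le_lt_trans hs'; rewrite ler_wpM2l // lerDl.
have ga0 : ga 0 = z0 by rewrite /ga rmorph0 mul0r addr0.
have ga1 : ga 1 = z1 by rewrite /ga rmorph1 mul1r addrC subrK.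
have h0 s : s \in `[0, 1] -> h s != 0.
  move=> /ga_upper/phi1 /orP[] /eqP e; rewrite /h e ?oppr_eq0 ?oner_eq0 //.
apply/eqP/negPn/negP => ne.
have : Num.min (h 0) (h 1) <= 0 <= Num.max (h 0) (h 1).
  rewrite /h ga0 ga1; move: ne.
  case/orP: (phi1 z0 hz0) => /eqP ->; case/orP: (phi1 z1 hz1) => /eqP -> /=;
    rewrite ?eqxx //= ge_min le_max ?oppr_le0 ?ler01 ?orbT //.
case/(IVT ler01 (continuous_in_subspaceT hcont)) => s hs /eqP.
by rewrite (negPf (h0 s hs)).
Unshelve. all: by end_near.
Qed.

(** * The automorphy cocycle and the group laws *)

Lemma mob_den (c d a' b' c' d' : int) (t : C) : a' * d' - b' * c' = 1 ->
  upper t ->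
  (c%:~R * mob a' b' c' d' t + d%:~R) * (c'%:~R * t + d'%:~R) =
  (c * a' + d * c')%:~R * t + (c * b' + d * d')%:~R.
Proof.
move=> h ht; have := upper_neq0 ht (det_row_neq0 h).
rewrite /mob => hn; rewrite !intrD !intrM.
by field.
Qed.

Lemma mob_mob (a b c d a' b' c' d' : int) (t : C) : a * d - b * c = 1 ->
  a' * d' - b' * c' = 1 -> upper t ->
  mob a b c d (mob a' b' c' d' t) =
  mob (a * a' + b * c') (a * b' + b * d') (c * a' + d * c') (c * b' + d * d') t.
Proof.
move=> h h' ht; have hn := upper_neq0 ht (det_row_neq0 h').
have hn' := upper_neq0 (upper_mob h' ht) (det_row_neq0 h).
rewrite {1}/mob -(mulfK hn (_ + _)) -[X in _ / X](mulfK hn).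
rewrite !mob_den // invfM invrK mulrACA mulVf // mulr1.
by [].
Qed.

Lemma mob_id (t : C) : mob 1 0 0 1 t = t.
Proof. by rewrite /mob mul1r mul0r addr0 add0r divr1. Qed.

Lemma mp2_eq (g h : mp2) : ma g = ma h -> mb g = mb h -> mc g = mc h ->
  md g = md h -> (forall t, upper t -> mphi g t = mphi h t) ->
  (forall t, ~ upper t -> mphi g t = 0) -> (forall t, ~ upper t -> mphi h t = 0) ->
  g = h.
Proof.
case: g => a b c d p; case: h => a' b' c' d' p' /= -> -> -> -> hp hg hh.
congr Mp2; apply/funext => t; have [ht|ht] := pselect (upper t).
  exact: hp.
by rewrite hg // hh.
Qed.

Lemma upper_act g t : valid g -> upper t -> upper (act g t).
Proof. by case=> h _ _ _; apply: upper_mob. Qed.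

Lemma act_den_neq0 g t : valid g -> upper t -> (mc g)%:~R * t + (md g)%:~R != 0 :> C.
Proof. by case=> h _ _ _ ht; apply: upper_neq0 (det_row_neq0 h). Qed.

Lemma mphi_neq0 g t : valid g -> upper t -> mphi g t != 0.
Proof.
move=> vg ht; have := act_den_neq0 vg ht; case: vg => _ _ h _.
by rewrite -h // expf_eq0.
Qed.

Lemma act_mul g h t : valid g -> valid h -> upper t ->
  act (mp2mul g h) t = act g (act h t).
Proof. by move=> [dg _ _ _] [dh _ _ _] ht; rewrite /act mob_mob. Qed.

Lemma mphi_mul g h t : upper t ->
  mphi (mp2mul g h) t = mphi g (act h t) * mphi h t.
Proof. by move=> ht /=; rewrite asboolT. Qed.

Lemma valid_mul g h : valid g -> valid h -> valid (mp2mul g h).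
Proof.
move=> vg vh; have [dg hg sg zg] := vg; have [dh hh sh zh] := vh; split.
- rewrite /=; transitivity ((ma g * md g - mb g * mc g) * (ma h * md h - mb h * mc h)).
    by ring.
  by rewrite dg dh.
- apply: (holoH_ext (f := fun t => mphi g (act h t) * mphi h t)).
    by move=> t ht; rewrite mphi_mul.
  apply: holoHM hh; apply: (holoH_comp (f := mphi g) (g := act h)) hg _.
    by move=> t; apply: upper_act.
  exact: holoH_mob.
- move=> t ht; rewrite mphi_mul // exprMn sg ?sh //; last exact: upper_act.
  exact: mob_den.
- by move=> t ht /=; rewrite asboolF.
Qed.

Lemma det_inv g : valid g -> md g * ma g - (- mb g) * (- mc g) = 1.
Proof. by case=> h _ _ _; rewrite -h; ring. Qed.

Lemma act_inv_l g t : valid g -> upper t -> act (mp2inv g) (act g t) = t.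
Proof.
move=> vg ht; have di := det_inv vg; have [dg _ _ _] := vg.
rewrite /act /= mob_mob // -[RHS]mob_id; congr (mob _ _ _ _ t); lia.
Qed.

Lemma upper_act_inv g t : valid g -> upper t -> upper (act (mp2inv g) t).
Proof. by move=> /det_inv; apply: upper_mob. Qed.

Lemma mphi_inv g t : upper t -> mphi (mp2inv g) t = (mphi g (act (mp2inv g) t))^-1.
Proof. by move=> ht; rewrite /= asboolT. Qed.

Lemma valid_inv g : valid g -> valid (mp2inv g).
Proof.
move=> vg; have [dg hg sg zg] := vg; have di := det_inv vg; split.
- exact: di.
- apply: (holoH_ext (f := fun t => (mphi g (act (mp2inv g) t))^-1)).
    by move=> t ht; rewrite mphi_inv.
  apply: holoHV.
    by move=> t ht; apply: mphi_neq0 => //; apply: upper_act_inv.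
  apply: (holoH_comp (f := mphi g) (g := act (mp2inv g))) hg _.
    by move=> t; apply: upper_act_inv.
  exact: holoH_mob.
- move=> t ht; rewrite mphi_inv // exprVn sg; last exact: upper_act_inv.
  have hX : ((mc g)%:~R * act (mp2inv g) t + (md g)%:~R) *
      ((mc (mp2inv g))%:~R * t + (md (mp2inv g))%:~R) = 1 :> C.
    rewrite [LHS]mob_den //= (_ : mc g * md g + _ = 0); last by ring.
    by rewrite mul0r add0r -[RHS]/(1%:~R); congr (_%:~R); rewrite -dg; ring.
  have h0 : (mc g)%:~R * act (mp2inv g) t + (md g)%:~R != 0 :> C.
    by apply: act_den_neq0 => //; apply: upper_act_inv.
  by apply: (mulfI h0); rewrite divff // hX.
- by move=> t ht /=; rewrite asboolF.
Qed.

Definition mp2one : mp2 := Mp2 1 0 0 1 (fun t => if `[< upper t >] then 1 else 0).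

Lemma valid_one : valid mp2one.
Proof.
split=> //=.
- apply: (holoH_ext (f := fun=> 1)) => [t ht|z _]; first by rewrite asboolT.
  exact: derivable_cst.
- by move=> t ht; rewrite asboolT // expr1n mul0r add0r.
- by move=> t ht; rewrite asboolF.
Qed.

Lemma mp2mulA f g h : valid f -> valid g -> valid h ->
  mp2mul f (mp2mul g h) = mp2mul (mp2mul f g) h.
Proof.
move=> vf vg vh; apply: mp2_eq => /=; try ring.
- move=> t ht; rewrite !asboolT //; last exact: upper_act.
  by rewrite mulrA -[act (Mp2 _ _ _ _ _) t]/(act (mp2mul g h) t) act_mul.
- by move=> t ht; rewrite asboolF.
- by move=> t ht; rewrite asboolF.
Qed.

Lemma mp2mul1 g : valid g -> mp2mul g mp2one = g.
Proof.
move=> vg; have [_ _ _ zg] := vg; apply: mp2_eq => //=; try ring.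
- by move=> t ht; rewrite !asboolT // mulr1 /act mob_id.
- by move=> t ht; rewrite asboolF.
Qed.

Lemma mp2_1mul g : valid g -> mp2mul mp2one g = g.
Proof.
move=> vg; have [_ _ _ zg] := vg; apply: mp2_eq => //=; try ring.
- by move=> t ht; rewrite !asboolT ?mul1r //; apply: upper_act.
- by move=> t ht; rewrite asboolF.
Qed.

Lemma mp2mulV g : valid g -> mp2mul g (mp2inv g) = mp2one.
Proof.
move=> vg; have [dg _ _ zg] := vg; apply: mp2_eq => /=; try lia.
- move=> t ht; rewrite !asboolT // divff //.
  by apply: mphi_neq0 => //; apply: upper_act_inv.
- by move=> t ht; rewrite asboolF.
- by move=> t ht; rewrite asboolF.
Qed.

Lemma mp2mulVg g : valid g -> mp2mul (mp2inv g) g = mp2one.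
Proof.
move=> vg; have [dg _ _ zg] := vg; apply: mp2_eq => /=; try lia.
- move=> t ht; rewrite !asboolT //; last exact: upper_act.
  rewrite -[mob _ _ _ _ _]/(act (mp2inv g) (act g t)) act_inv_l // mulVf //.
  exact: mphi_neq0.
- by move=> t ht; rewrite asboolF.
- by move=> t ht; rewrite asboolF.
Qed.

Lemma mp2invK g : valid g -> mp2inv (mp2inv g) = g.
Proof.
move=> vg; have vi := valid_inv vg; have vii := valid_inv vi.
rewrite -[LHS]mp2_1mul // -(mp2mulV vg) -mp2mulA //.
by rewrite mp2mulV // mp2mul1.
Qed.

Lemma mp2invM g h : valid g -> valid h ->
  mp2inv (mp2mul g h) = mp2mul (mp2inv h) (mp2inv g).
Proof.
move=> vg vh; have vi := valid_inv vg; have vj := valid_inv vh.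
have vgh := valid_mul vg vh; have vk := valid_inv vgh; have vji := valid_mul vj vi.
rewrite -[RHS](mp2mul1 vji) -(mp2mulV vgh) (mp2mulA vji vgh vk).
rewrite -(mp2mulA vj vi vgh) (mp2mulA vi vg vh) mp2mulVg // mp2_1mul //.
by rewrite mp2mulVg // mp2_1mul.
Qed.

Definition mp2T : mp2 := Mp2 1 1 0 1 (fun t => if `[< upper t >] then 1 else 0).
Definition mp2S : mp2 := Mp2 0 (-1) 1 0 upper_sqrt.

Lemma valid_T : valid mp2T.
Proof.
have [_ h1 h2 h3] := valid_one; split=> //.
Qed.

Lemma valid_S : valid mp2S.
Proof.
split=> //.
- exact: holoH_sqrt.
- by move=> t ht /=; rewrite mul1r addr0 sqr_upper_sqrt.
- by move=> t ht /=; rewrite /upper_sqrt asboolF.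
Qed.

Lemma upper_i : upper ('i%C : Rr[i]).
Proof. by rewrite /upper /= ltr01. Qed.

(** * Generation by S and T, as an induction principle *)

Section Generation.
Variable P : mp2 -> Prop.
Hypotheses (PS : P mp2S) (PT : P mp2T).
Hypothesis PM : forall g h, valid g -> valid h -> P g -> P h -> P (mp2mul g h).
Hypothesis PV : forall g, valid g -> P g -> P (mp2inv g).

Let P1 : P mp2one.
Proof.
rewrite -(mp2mulV valid_S).
exact: PM valid_S (valid_inv valid_S) PS (PV valid_S PS).
Qed.

Let Pcancel g h : valid g -> valid h -> P h -> P (mp2mul h g) -> P g.
Proof.
move=> vg vh Ph Phg; have vi := valid_inv vh.
rewrite -(mp2_1mul vg) -(mp2mulVg vh) -mp2mulA //.
by apply: PM => //; [apply: valid_mul | apply: PV].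
Qed.

(** Only the matrix of the power of T is prescribed; the sign of the square root is settled by
    [gen_kernel]. *)
Lemma gen_translation (k : int) :
  exists g, [/\ valid g, P g, ma g = 1, mb g = k & mc g = 0 /\ md g = 1].
Proof.
have nat_case (n : nat) :
    exists g, [/\ valid g, P g, ma g = 1, mb g = n & mc g = 0 /\ md g = 1].
  elim: n => [|n [g [vg Pg ag bg [cg dg]]]].
    by exists mp2one; split=> //; apply: valid_one.
  exists (mp2mul mp2T g); rewrite /= ag bg cg dg; split; last by split.
  - exact: valid_mul valid_T vg.
  - exact: PM valid_T vg PT Pg.
  - by lia.
  - by lia.
case: (intP k) => [|n|n]; [exact: nat_case | exact: nat_case |].
have [g [vg Pg ag bg [cg dg]]] := nat_case n.+1.
by exists (mp2inv g); rewrite /= ag bg cg dg; split=> //; [exact: valid_inv | exact: PV].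
Qed.

Let W := mp2mul mp2S mp2S.

Let vW : valid W. Proof. exact: valid_mul valid_S valid_S. Qed.

Let PW : P W. Proof. exact: PM valid_S valid_S PS PS. Qed.

(** Over the identity matrix [mphi z] is constantly 1 or -1 by [sqr1_const]. The sign -1 is the
    square of [W], which acts trivially on H and whose [mphi] squares to -1. *)
Lemma gen_kernel z : valid z -> ma z = 1 -> mb z = 0 -> mc z = 0 -> md z = 1 -> P z.
Proof.
move=> vz az bz cz dz; have [_ hz sz oz] := vz.
have s1 t : upper t -> mphi z t ^+ 2 = 1.
  by move=> ht; rewrite sz // cz dz mul0r add0r.
have cst t (ht : upper t) := sqr1_const hz s1 ht upper_i.
have := s1 _ upper_i; move: cst; set w := mphi z _ => cst /eqP.
rewrite sqrf_eq1 => /orP[] /eqP e.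
  rewrite (_ : z = mp2one) //; apply: mp2_eq => //.
    by move=> t ht; rewrite cst // e /= asboolT.
  by move=> t ht /=; rewrite asboolF.
have sW t : upper t -> mphi W t ^+ 2 = -1.
  case: vW => _ _ sW _ ht; rewrite sW // (_ : mc W = 0) // (_ : md W = -1) //.
  by rewrite mul0r add0r rmorphN.
rewrite (_ : z = mp2mul W W); first exact: PM vW vW PW PW.
apply: mp2_eq => //; rewrite ?az ?bz ?cz ?dz //.
  move=> t ht; rewrite cst // e mphi_mul //.
  rewrite (_ : act W t = t); first by rewrite -expr2 sW.
  rewrite /act (_ : ma W = -1) // (_ : mb W = 0) // (_ : mc W = 0) // (_ : md W = -1) //.
  by rewrite /mob mul0r add0r addr0 rmorphN mulN1r invrN1 mulrN1 opprK.
by move=> t ht /=; rewrite asboolF.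
Qed.

(** The diagonal is 1 or -1; multiplication by [W] reduces to 1, and a translation then leads to
    [gen_kernel]. *)
Lemma gen_triangular g : valid g -> mc g = 0 -> P g.
Proof.
have pos h : valid h -> mc h = 0 -> ma h = 1 -> P h.
  move=> vh ch ah; have [dh _ _ _] := vh.
  have dh1 : md h = 1 by move: dh; rewrite ch ah; lia.
  have [k [vk Pk ak bk [ck dk]]] := gen_translation (- mb h).
  apply: (Pcancel vh vk Pk); apply: gen_kernel => [|||| ]; first exact: valid_mul.
  - by rewrite /= ak bk ah ch; lia.
  - by rewrite /= ak bk dh1; lia.
  - by rewrite /= ck dk ah ch; lia.
  - by rewrite /= ck dk dh1; lia.
move=> vg cg; have [dg _ _ _] := vg.
have : ma g = 1 \/ ma g = -1.
  have : ma g * md g = 1 by move: dg; rewrite cg; lia.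
  move/(congr1 absz); rewrite abszM => /eqP; rewrite muln_eq1 => /andP[/eqP h _].
  by move: h; lia.
case=> ag; first exact: pos.
apply: (Pcancel vg vW); first exact: PW.
apply: pos; first exact: valid_mul.
  by rewrite /= cg; lia.
by rewrite /= ag cg; lia.
Qed.

(** Euclid's algorithm on the first column: a translation replaces [ma g] by its remainder modulo
    [mc g], and S moves that remainder into the lower left entry. *)
Lemma mp2_generated g : valid g -> P g.
Proof.
have [n] := ubnP (absz (mc g)); elim: n g => // n IH g.
rewrite ltnS => hn vg; have [cg|cg] := eqVneq (mc g) 0; first exact: gen_triangular.
pose k := (ma g %/ mc g)%Z; have ek := divz_eq (ma g) (mc g).
have [h [vh Ph ah bh [ch dh]]] := gen_translation (- k).
have vhg := valid_mul vh vg.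
apply: (Pcancel vg vh Ph); apply: (Pcancel vhg valid_S PS).
apply: IH; last exact: valid_mul valid_S vhg.
apply: leq_trans hn; rewrite /= ah bh ch dh !mul1r !mul0r addr0.
have := modz_ge0 (ma g) cg; have := ltz_mod (ma g) cg; rewrite -/k in ek *.
move: (ma g %% mc g)%Z ek => r ->; lia.
Qed.

End Generation.

(** * Discriminant forms *)

Lemma is_intP (x : rat) : reflect (exists z : int, x = z%:~R) (is_int x).
Proof. by rewrite /is_int -Qint_def; apply: intrP. Qed.

Lemma is_int_int (x : rat) : is_int x = (x \is a Num.int).
Proof. by rewrite /is_int -Qint_def. Qed.

Lemma eCD x y : eC (x + y) = eC x * eC y.
Proof.
rewrite /eC rmorphD mulrDr trigo.cosD trigo.sinD; congr Complex => //.
by rewrite /= addrC; congr (_ + _); rewrite mulrC.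
Qed.

Lemma eC0 : eC 0 = 1.
Proof. by rewrite /eC rmorph0 mulr0 cos0 sin0. Qed.

Lemma eC1 : eC 1 = 1.
Proof.
rewrite /eC rmorph1 mulr1 mulr_natl mulr2n (trigo.cosD pi pi) (trigo.sinD pi pi) cospi sinpi.
by rewrite !mulr0 !mul0r subr0 addr0 mulrNN mulr1.
Qed.

Lemma eCN x : eC (- x) = (eC x)^-1.
Proof.
have h : eC x * eC (- x) = 1 by rewrite -eCD subrr eC0.
have h0 : eC x != 0.
  by apply/eqP => e; move/eqP: h; rewrite e mul0r eq_sym oner_eq0.
by apply: (mulfI h0); rewrite h divff.
Qed.

Lemma eC_neq0 x : eC x != 0.
Proof.
apply/eqP => e; have := eC0; rewrite -(subrr x) eCD e mul0r => /eqP.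
by rewrite eq_sym oner_eq0.
Qed.

Lemma eC_conj x : ((eC x : Rr[i])^*)%C = eC (- x).
Proof. by rewrite /eC /= rmorphN mulrN cosN sinN. Qed.

Lemma eC_nat (n : nat) : eC n%:R = 1.
Proof.
by elim: n => [|n IH]; rewrite ?eC0 // -addn1 natrD eCD IH eC1 mulr1.
Qed.

Lemma eC_int x : is_int x -> eC x = 1.
Proof.
move/is_intP => [[n|n] ->]; first exact: eC_nat.
by rewrite NegzE rmorphN eCN (eC_nat n.+1 : eC (Posz n.+1)%:~R = 1) invr1.
Qed.

(** For the fractional part [r], a nonzero value would put [pi * r] strictly between 0 and pi, where
    the sine is positive, against [cos (2 * pi * r) = 1]. *)
Lemma eC_eq1 x : eC x = 1 -> is_int x.
Proof.
move=> h; rewrite is_int_int.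
pose r := x - (Num.floor x)%:~R.
have er : eC r = 1.
  rewrite eCD h mul1r eCN eC_int ?invr1 //; apply/is_intP; by exists (Num.floor x).
have [r0|r0] := eqVneq r 0.
  have -> : x = (Num.floor x)%:~R by apply/eqP; rewrite -subr_eq0 -/r r0.
  exact: intr_int.
have /andP[h1 h2] := floor_itv x.
have r_gt0 : 0 < r by rewrite lt_neqAle eq_sym r0 subr_ge0.
have r_lt1 : r < 1 by rewrite ltrBlDl addrC -[1]/(1%:~R) addrC -intrD.
have [hc _] : cos (2 * pi * ratr r) = 1 :> Rr /\ sin (2 * pi * ratr r) = 0 :> Rr.
  by have [-> ->] := er.
pose th : Rr := pi * ratr r.
have th_gt0 : 0 < th by rewrite mulr_gt0 ?pi_gt0 // ltr0q.
have th_ltpi : th < pi by rewrite gtr_pMr ?pi_gt0 // -(rmorph1 ratr) ltr_rat.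
have := sin_gt0_pi; move/(_ _ th); rewrite th_gt0 th_ltpi => /(_ isT) hs.
move: hc; rewrite -mulrA mulr_natl mulr2n -/th trigo.cosD.
have := cos2Dsin2 th; rewrite !expr2 => h3 h4; exfalso; clear -hs h3 h4; nra.
Qed.

Lemma eC_eq x y : eC x = eC y -> is_int (x - y).
Proof. by move=> h; apply: eC_eq1; rewrite eCD eCN h divff // eC_neq0. Qed.

Section DiscriminantGroup.
Variables (n : nat) (G : 'M[int]_n).
Hypothesis d_gt0 : (0 < dG G)%N.
Local Notation d := ((dG G)%:Z).

Definition coord (y : Disc G) (j : 'I_n) : int := nat_of_ord (val y j).

Let d_neq0 : d != 0. Proof. by case: (dG G) d_gt0. Qed.

Lemma coord_bound (y : Disc G) j : 0 <= coord y j < d.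
Proof. by rewrite /coord ltz_nat ltn_ord. Qed.

Lemma coord_mod (y : Disc G) j : (coord y j %% d)%Z = coord y j.
Proof. by rewrite modz_small // coord_bound. Qed.

Lemma coord_dvd (y : Disc G) i : (d %| \sum_j G i j * coord y j)%Z.
Proof. exact: (forallP (valP y) i). Qed.

Lemma coord_inj (y z : Disc G) : coord y =1 coord z -> y = z.
Proof.
move=> h; apply/val_inj/ffunP => j; apply/val_inj.
by have := h j; rewrite /coord => -[].
Qed.

Definition mk_ffun (v : 'I_n -> int) : {ffun 'I_n -> 'I_(dG G)} :=
  [ffun j => Ordinal (ltn_pmod `|(v j %% d)%Z|%N d_gt0)].

Lemma mk_ffunE v j : (nat_of_ord (mk_ffun v j))%:Z = (v j %% d)%Z.
Proof.
rewrite ffunE /= -modz_nat gez0_abs ?modz_ge0 // modz_mod //.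
Qed.

(** Says that [v] divided by [dG G] lies in the dual lattice. *)
Definition is_dual (v : 'I_n -> int) := forall i, (d %| \sum_j G i j * v j)%Z.

Lemma dual_congr (v w : 'I_n -> int) : (forall j, (d %| v j - w j)%Z) ->
  is_dual v -> is_dual w.
Proof.
move=> h hv i.
rewrite (_ : \sum_j _ = \sum_j G i j * v j - \sum_j G i j * (v j - w j)).
  by rewrite rpredB ?hv // rpred_sum // => j _; rewrite dvdz_mull.
by rewrite -sumrB; apply: eq_bigr => j _; ring.
Qed.

Lemma dvd_mod (a : int) : (d %| a - (a %% d)%Z)%Z.
Proof. by rewrite {1}(divz_eq a d) addrK dvdz_mull. Qed.

Lemma mk_pred (v : 'I_n -> int) : is_dual v -> discr_pred (mk_ffun v).
Proof.
move=> hv; apply/forallP => i; under eq_bigr => j _ do rewrite mk_ffunE.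
by apply: dual_congr hv i => j; apply: dvd_mod.
Qed.

Definition mk (v : 'I_n -> int) (hv : is_dual v) : Disc G := exist _ (mk_ffun v) (mk_pred hv).

Lemma coord_mk v (hv : is_dual v) j : coord (mk hv) j = (v j %% d)%Z.
Proof. exact: mk_ffunE. Qed.

Lemma mk_dvd v (hv : is_dual v) j : (d %| v j - coord (mk hv) j)%Z.
Proof. by rewrite coord_mk dvd_mod. Qed.

Lemma coord_eq (y z : Disc G) : (forall j, (d %| coord y j - coord z j)%Z) -> y = z.
Proof.
move=> h; apply: coord_inj => j; have := h j.
by rewrite -eqz_mod_dvd !coord_mod => /eqP.
Qed.

Lemma dual_add (y z : Disc G) : is_dual (fun j => coord y j + coord z j).
Proof.
move=> i; under eq_bigr => j _ do rewrite mulrDr.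
by rewrite big_split rpredD //; apply: coord_dvd.
Qed.

Lemma dual_opp (y : Disc G) : is_dual (fun j => - coord y j).
Proof.
move=> i; under eq_bigr => j _ do rewrite mulrN.
by rewrite sumrN rpredN; apply: coord_dvd.
Qed.

Lemma dual_zero : is_dual (fun=> 0).
Proof. by move=> i; rewrite big1 // => j _; rewrite mulr0. Qed.

Definition disc_add y z := mk (dual_add y z).
Definition disc_opp y := mk (dual_opp y).
Definition disc_zero := mk dual_zero.

Lemma disc_add_dvd y z j : (d %| coord y j + coord z j - coord (disc_add y z) j)%Z.
Proof. exact: mk_dvd (dual_add y z) j. Qed.

Lemma disc_opp_dvd y j : (d %| - coord y j - coord (disc_opp y) j)%Z.
Proof. exact: mk_dvd (dual_opp y) j. Qed.

Lemma disc_zeroE j : coord disc_zero j = 0.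
Proof. by rewrite coord_mk mod0z. Qed.

Lemma disc_addA : associative disc_add.
Proof.
move=> x y z; apply: coord_eq => j.
have h1 := disc_add_dvd y z j; have h2 := disc_add_dvd x y j.
have h3 := disc_add_dvd x (disc_add y z) j; have h4 := disc_add_dvd (disc_add x y) z j.
rewrite (_ : _ - _ = (coord (disc_add x y) j + coord z j - coord (disc_add (disc_add x y) z) j)
   + (coord x j + coord y j - coord (disc_add x y) j)
   - (coord x j + coord (disc_add y z) j - coord (disc_add x (disc_add y z)) j)
   - (coord y j + coord z j - coord (disc_add y z) j)); last by ring.
by apply: rpredB h1; apply: rpredB h3; apply: rpredD h4 h2.
Qed.

Lemma disc_addC : commutative disc_add.
Proof. by move=> x y; apply: coord_inj => j; rewrite !coord_mk addrC. Qed.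

Lemma disc_add0 : left_id disc_zero disc_add.
Proof. by move=> x; apply: coord_inj => j; rewrite coord_mk disc_zeroE add0r coord_mod. Qed.

Lemma disc_addN : left_inverse disc_zero disc_opp disc_add.
Proof.
move=> x; apply: coord_eq => j; rewrite disc_zeroE subr0.
have h1 := disc_opp_dvd x j; have h2 := disc_add_dvd (disc_opp x) x j.
rewrite (_ : coord _ _ = - (coord (disc_opp x) j + coord x j - coord (disc_add (disc_opp x) x) j)
  - (- coord x j - coord (disc_opp x) j)); last by ring.
apply: rpredB; [rewrite rpredN; exact: h2 | exact: h1].
Qed.

End DiscriminantGroup.

(* A copy of Disc G carrying the group structure, which exists only when the
   index type 'I_(dG G) is inhabited. *)
Definition discz n (G : 'M[int]_n) (h : (0 < dG G)%N) : Type := Disc G.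
HB.instance Definition _ n (G : 'M[int]_n) (h : (0 < dG G)%N) :=
  Finite.copy (discz h) (Disc G).
HB.instance Definition _ n (G : 'M[int]_n) (h : (0 < dG G)%N) :=
  GRing.isZmodule.Build (discz h) (disc_addA h) (disc_addC h) (disc_add0 h) (disc_addN h).

(** * The quadratic form on the discriminant group *)

Section DiscriminantForm.
Variables (n : nat) (G : 'M[int]_n).
Hypothesis evenG : even_lattice G.

Definition bform (u v : 'cV[rat]_n) : rat := (u^T *m GQ G *m v) 0 0.
Definition intvec (k : 'cV[int]_n) : 'cV[rat]_n := map_mx (fun z : int => z%:~R) k.

Lemma dG_gt0 : (0 < dG G)%N.
Proof. by have [_ _ h] := evenG; rewrite /dG lt0n absz_eq0. Qed.

Let G_sym : G^T = G. Proof. by have [] := evenG. Qed.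

Lemma bformC u v : bform u v = bform v u.
Proof.
rewrite /bform -[in LHS](trmxK (_ *m v)) mxE !trmx_mul trmxK /GQ map_trmx G_sym.
by rewrite mulmxA.
Qed.

Lemma bformDl u u' v : bform (u + u') v = bform u v + bform u' v.
Proof. by rewrite /bform linearD /= !mulmxDl mxE. Qed.

Lemma bformDr u v v' : bform u (v + v') = bform u v + bform u v'.
Proof. by rewrite /bform mulmxDr mxE. Qed.

Lemma bformNr u v : bform u (- v) = - bform u v.
Proof. by rewrite /bform mulmxN mxE. Qed.

Lemma bformNl u v : bform (- u) v = - bform u v.
Proof. by rewrite bformC bformNr bformC. Qed.

Lemma qformE u : qform G u = bform u u / 2.
Proof. by []. Qed.

Lemma qformD u v : qform G (u + v) = qform G u + qform G v + bform u v.
Proof. rewrite !qformE bformDl !bformDr (bformC v u); lra. Qed.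

Lemma qformN u : qform G (- u) = qform G u.
Proof. by rewrite !qformE bformNl bformNr opprK. Qed.

Lemma bform_dual u k : in_dual G u -> is_int (bform u (intvec k)).
Proof.
move=> hu; rewrite bformC /bform -mulmxA mxE is_int_int.
apply: rpred_sum => i _; rewrite !mxE rpredM ?intr_int //.
by have := hu i; rewrite is_int_int mxE.
Qed.

(** Off-diagonal terms pair up by symmetry; with an even diagonal this makes the norm of a lattice
    vector even. *)
Lemma sum_sym_even (a : 'I_n -> 'I_n -> int) : (forall i j, a i j = a j i) ->
  (forall i, (2 %| a i i)%Z) -> (2 %| \sum_i \sum_j a i j)%Z.
Proof.
move=> asym adiag.
pose up := \sum_(i < n) \sum_(j < n | (i < j)%N) a i j.
have -> : \sum_i \sum_j a i j = \sum_i a i i + (up + up).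
  have -> : up + up = up + \sum_(i < n) \sum_(j < n | (j < i)%N) a i j.
    congr (_ + _); rewrite /up (exchange_big_dep xpredT) //=.
    by apply: eq_bigr => i _; apply: eq_bigr => j _.
  rewrite -!big_split /=; apply: eq_bigr => i _.
  rewrite (bigD1 i) //= (bigID (fun j : 'I_n => (i < j)%N)) /=; congr (_ + (_ + _)).
    by apply: eq_bigl => j; case: eqVneq => [->|]; rewrite ?ltnn // andTb.
  by apply: eq_bigl => j; rewrite -leqNgt ltn_neqAle.
apply: rpredD; first by apply: rpred_sum => i _; apply: adiag.
by apply/dvdzP; exists up; rewrite mulr_natr mulr2n.
Qed.

Lemma qform_int k : is_int (qform G (intvec k)).
Proof.
rewrite qformE.
have -> : bform (intvec k) (intvec k) = (\sum_i \sum_j k i 0 * (G i j * k j 0))%:~R.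
  rewrite /bform -mulmxA mxE rmorph_sum; apply: eq_bigr => i _.
  rewrite !mxE rmorph_sum mulr_sumr; apply: eq_bigr => j _.
  by rewrite !mxE !rmorphM.
have /dvdzP[q ->] : (2 %| \sum_i \sum_j k i 0%R * (G i j * k j 0%R))%Z.
  apply: sum_sym_even => [i j|i].
    by rewrite -[in LHS]G_sym mxE; ring.
  by apply: dvdz_mull; apply: dvdz_mulr; have [_ h _] := evenG.
by apply/is_intP; exists q; rewrite rmorphM /= mulfK.
Qed.

Lemma eC_shift x y : is_int y -> eC (x + y) = eC x.
Proof. by move=> hy; rewrite eCD (eC_int hy) mulr1. Qed.

Lemma is_intN x : is_int (- x) = is_int x.
Proof. by rewrite !is_int_int rpredN. Qed.

Lemma eC_qform_shift u k : in_dual G u -> eC (qform G (u + intvec k)) = eC (qform G u).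
Proof.
by move=> hu; rewrite qformD !eC_shift //; [exact: qform_int | exact: bform_dual].
Qed.

Lemma eC_bform_shift u k v : in_dual G v ->
  eC (bform (u + intvec k) v) = eC (bform u v).
Proof. by move=> hv; rewrite bformDl eC_shift // bformC bform_dual. Qed.

Definition colQ (a : 'I_n -> int) : 'cV[rat]_n := \col_i ((a i)%:~R / (dG G)%:R).

Lemma dvecE (y : Disc G) : dvec y = colQ (coord y).
Proof. by apply/colP => i; rewrite !mxE. Qed.

Lemma dGQ_neq0 : (dG G)%:R != 0 :> rat.
Proof. by rewrite pnatr_eq0 -lt0n dG_gt0. Qed.

Lemma dvec_shift (a : 'I_n -> int) (y : Disc G) :
  (forall j, ((dG G)%:Z %| a j - coord y j)%Z) -> exists k, dvec y = colQ a + intvec k.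
Proof.
move=> h; exists (\col_j - ((a j - coord y j) %/ (dG G)%:Z)%Z).
rewrite dvecE; apply/colP => j; rewrite !mxE rmorphN /=.
have := h j; rewrite dvdz_eq => /eqP e.
have : (a j)%:~R - (coord y j)%:~R = ((a j - coord y j) %/ (dG G)%:Z)%Z%:~R * (dG G)%:R :> rat.
  by rewrite -rmorphB -[in LHS]e rmorphM.
move: (_ %/ _)%Z => q e'; apply: (mulIf dGQ_neq0).
rewrite mulrDl mulfVK ?dGQ_neq0 // mulfVK ?dGQ_neq0 // mulNr -e'; ring.
Qed.

Lemma dvec_dual (y : Disc G) : in_dual G (dvec y).
Proof.
move=> i; rewrite dvecE mxE.
have -> : \sum_j GQ G i j * colQ (coord y) j 0 =
    (\sum_j G i j * coord y j)%:~R / (dG G)%:R.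
  by rewrite rmorph_sum mulr_suml; apply: eq_bigr => j _; rewrite !mxE rmorphM mulrA.
have /dvdzP[q ->] := coord_dvd y i.
by apply/is_intP; exists q; rewrite rmorphM /= mulfK // dGQ_neq0.
Qed.

Lemma dvec_add (y z : Disc G) :
  exists k, dvec (disc_add dG_gt0 y z) = dvec y + dvec z + intvec k.
Proof.
have [k ->] := dvec_shift (disc_add_dvd dG_gt0 y z); exists k; congr (_ + _).
by rewrite !dvecE; apply/colP => i; rewrite !mxE rmorphD mulrDl.
Qed.

Lemma dvec_opp (y : Disc G) :
  exists k, dvec (disc_opp dG_gt0 y) = - dvec y + intvec k.
Proof.
have [k ->] := dvec_shift (disc_opp_dvd dG_gt0 y); exists k; congr (_ + _).
by rewrite !dvecE; apply/colP => i; rewrite !mxE rmorphN mulNr.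
Qed.

Lemma in_dualD u v : in_dual G u -> in_dual G v -> in_dual G (u + v).
Proof. by move=> hu hv i; rewrite mulmxDr mxE is_int_int rpredD // -is_int_int. Qed.

Lemma in_dualN u : in_dual G u -> in_dual G (- u).
Proof. by move=> hu i; rewrite mulmxN mxE is_intN. Qed.

(** The codomain is [Rr[i]] because [C] is declared only as a [numFieldType], while unitarity needs
    complex conjugation. *)
Definition dq (y : discz dG_gt0) : Rr[i] := eC (qD y).
Definition db (y z : discz dG_gt0) : Rr[i] := eC (bD y z).

(** The test vector is a column of the adjugate over [dG G], up to sign a column of the inverse Gram
    matrix. Pairing with it returns a coordinate of [x] up to sign, which is then an integer in
    [0,1). *)
Lemma disc_nondeg (x : discz dG_gt0) : (forall y, db x y = 1) -> x = 0.
Proof.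
move=> h; apply: coord_inj => i; rewrite (disc_zeroE dG_gt0).
pose v j := \adj G j i.
have Gv k : \sum_j G k j * v j = \det G *+ (k == i).
  by have := congr1 (fun M : 'M[int]_n => M k i) (mul_mx_adj G); rewrite !mxE => <-.
have hv : is_dual G v.
  by move=> k; rewrite Gv /dG; case: eqP; rewrite ?mulr1n ?mulr0n ?dvdz0 // dvdzE /=.
pose y := mk dG_gt0 hv.
have [k hk] := dvec_shift (mk_dvd dG_gt0 hv).
have /eC_eq1 := h y; rewrite -[bD x y]/(bform (dvec x) (dvec y)) hk bformDr.
rewrite is_int_int => hint.
have {hint} : bform (dvec x) (colQ v) \is a Num.int.
  rewrite -[bform _ _](addrK (bform (dvec x) (intvec k))) rpredB //.
  by rewrite -is_int_int bform_dual //; apply: dvec_dual.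
have -> : bform (dvec x) (colQ v) = (\det G)%:~R / (dG G)%:R * dvec x i 0.
  rewrite /bform -mulmxA mxE (bigD1 i) //= big1 => [|j ji].
    rewrite addr0 mulrC !mxE; congr (_ * _).
    transitivity ((\sum_j G i j * v j)%:~R / (dG G)%:R : rat).
      by rewrite rmorph_sum mulr_suml; apply: eq_bigr => j _; rewrite !mxE rmorphM mulrA.
    by rewrite Gv eqxx mulr1n.
  rewrite !mxE (_ : \sum_j0 _ = (\sum_k G j k * v k)%:~R / (dG G)%:R).
    by rewrite Gv (negPf ji) mulr0n mul0r mulr0.
  by rewrite rmorph_sum mulr_suml; apply: eq_bigr => l _; rewrite !mxE rmorphM mulrA.
have sgn : (\det G)%:~R / (dG G)%:R = 1 :> rat \/ (\det G)%:~R / (dG G)%:R = -1 :> rat.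
  have := dGQ_neq0; have -> : (dG G)%:R = (Posz (dG G))%:~R :> rat by [].
  rewrite /dG abszE.
  case: (ger0P (\det G)) => hd h0; first by left; rewrite divff.
  by right; rewrite rmorphN /= invrN mulrN divff // -oppr_eq0 -rmorphN.
have hc := coord_bound x i.
have main : (coord x i)%:~R / (dG G)%:R \is a @Num.int rat -> coord x i = 0.
  case/intrP => z hz; have hz' : coord x i = z * dG G.
    apply/eqP; rewrite -(eqr_int rat) rmorphM /= -hz mulfVK //; exact: dGQ_neq0.
  have d0 : 0 < (dG G)%:Z by rewrite ltz_nat dG_gt0.
  move: hc; rewrite hz' => /andP[]; rewrite pmulr_lge0 // => z0 z1.
  have z2 : z < 1 by rewrite -(ltr_pM2r d0) mul1r.
  have -> : z = 0 by clear -z0 z2; lia.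
  by rewrite mul0r.
rewrite dvecE mxE; case: sgn => ->; rewrite ?mul1r ?mulN1r ?rpredN; exact: main.
Qed.

Lemma disc_quadratic_module : quadratic_module dq db.
Proof.
split.
- by move=> x; apply: eC_neq0.
- move=> x; rewrite /dq; have [k hk] := dvec_opp x.
  rewrite /qD -[dvec (- x)]/(dvec (disc_opp dG_gt0 x)) hk.
  by rewrite eC_qform_shift ?qformN //; apply/in_dualN/dvec_dual.
- move=> x y; rewrite /dq; have [k hk] := dvec_add x y.
  rewrite /qD -[dvec (x + y)]/(dvec (disc_add dG_gt0 x y)) hk.
  rewrite eC_qform_shift ?qformD ?eCD //.
  by apply: in_dualD; apply: dvec_dual.
- by move=> x y; congr eC; apply: bformC.
- move=> x y z; rewrite /db; have [k hk] := dvec_add x y.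
  rewrite /bD -[dvec (x + y)]/(dvec (disc_add dG_gt0 x y)) hk.
  rewrite -[X in eC X]/(bform _ _) eC_bform_shift ?bformDl ?eCD //.
  exact: dvec_dual.
- exact: disc_nondeg.
Qed.

Lemma isZeroDE (y : discz dG_gt0) : isZeroD y = (y == 0).
Proof.
apply/forallP/eqP => [h|-> i].
  by apply: coord_inj => j; rewrite (disc_zeroE dG_gt0) /coord (eqP (h j)).
by have := disc_zeroE dG_gt0 i; rewrite /coord => -[->].
Qed.

Lemma addDE (x y z : discz dG_gt0) : addD x y z = (x + y == z).
Proof.
apply/forallP/eqP => [h|<- i].
  apply: coord_inj => j; rewrite (coord_mk dG_gt0 (dual_add x y)).
  by rewrite /coord -PoszD modz_nat (eqP (h j)).
have := coord_mk dG_gt0 (dual_add x y) i; rewrite /coord -PoszD modz_nat.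
by case=> ->.
Qed.

Lemma elementary_torsion (m : nat) (x : discz dG_gt0) :
  (forall u, in_dual G u -> forall i, is_int (m%:R * u i 0)) -> x *+ m = 0.
Proof.
move=> h.
have hc k j : ((dG G)%:Z %| coord x j * k%:Z - coord (x *+ k : discz dG_gt0) j)%Z.
  elim: k => [|k IH]; first by rewrite mulr0 sub0r mulr0n (disc_zeroE dG_gt0).
  have := disc_add_dvd dG_gt0 x (x *+ k) j.
  rewrite -[disc_add dG_gt0 x (x *+ k)]/(x + x *+ k) -mulrS => h2.
  rewrite (_ : _ - _ = (coord x j * k%:Z - coord (x *+ k : discz dG_gt0) j) +
    (coord x j + coord (x *+ k : discz dG_gt0) j - coord (x *+ k.+1 : discz dG_gt0) j)).
    exact: rpredD IH h2.
  by rewrite intS; ring.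
apply: coord_eq => j; rewrite (disc_zeroE dG_gt0) subr0.
rewrite -[coord _ j](subKr (coord x j * m%:Z)); apply: rpredB (hc m j).
have /is_intP[z hz] := h _ (dvec_dual x) j.
apply/dvdzP; exists z; apply/eqP; rewrite -(eqr_int rat) !rmorphM /= -hz.
rewrite dvecE mxE mulrA mulfVK ?dGQ_neq0 //.
by rewrite mulrC.
Qed.

Lemma level_torsion (N : nat) (x : discz dG_gt0) : level G N -> dq x ^+ N = 1.
Proof.
case=> _ h _; have e k : dq x ^+ k = eC (k%:R * qD x).
  elim: k => [|k IH]; first by rewrite mul0r eC0.
  by rewrite exprS IH -eCD -addn1 natrD mulrDl mul1r addrC.
by rewrite e eC_int // h //; apply: dvec_dual.
Qed.

End DiscriminantForm.

(** * Weil representations *)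

(** Positivity: for [X = A *m cokermx M] the Gram matrix of [X] is 0, so the columns of [X] have
    norm 0 and [X = 0]. *)
Lemma row_sub_gram (K : numClosedFieldType) (m p : nat) (A : 'M[K]_(m, p)) :
  (A <= (map_mx Num.conj A)^T *m A)%MS.
Proof.
set M := _ *m A; rewrite submxE; set X := A *m cokermx M.
have hX : (map_mx Num.conj X)^T *m X = 0.
  rewrite {1}/X map_mxM trmx_mul -mulmxA [_ *m X]mulmxA /X.
  by rewrite -/M mulmx_coker mulmx0.
apply/eqP/matrixP => i j; rewrite [RHS]mxE.
have : ((map_mx Num.conj X)^T *m X) j j = 0 by rewrite hX mxE.
rewrite mxE => /eqP; rewrite psumr_eq0 => [|k _]; last first.
  by rewrite !mxE mulrC mul_conjC_ge0.
move/allP/(_ i (mem_index_enum _)); rewrite !mxE /= mulrC mul_conjC_eq0.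
by move/eqP.
Qed.

Section WeilRepresentation.
Variables (K : numClosedFieldType) (D : finZmodType) (Q : D -> K) (B : D -> D -> K).
Hypothesis hQ : quadratic_module Q B.
Hypothesis Q_conj : forall x, (Q x)^* = (Q x)^-1.
Variables (rho : mp2 -> D -> D -> K) (kappa : K).
Hypothesis kappa_norm : kappa * kappa^* * #|D|%:R = 1.
Hypothesis rhoM : forall g h, valid g -> valid h ->
  forall d e, rho (mp2mul g h) d e = \sum_b rho g d b * rho h b e.
Hypothesis rhoT : forall d e, rho mp2T d e = if d == e then Q e else 0.
Hypothesis rhoS : forall d e, rho mp2S d e = kappa * (B e d)^-1.

Let Bn0 := pair_neq0 hQ.
Let Qn0 := quad_neq0 hQ.

Lemma pair_conj x y : (B x y)^* = (B x y)^-1.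
Proof.
have -> : B x y = Q (x + y) / (Q x * Q y).
  by rewrite (quadD hQ) [Q x * Q y * _]mulrC mulfK // mulf_neq0.
by rewrite fmorph_div rmorphM /= !Q_conj -!invfM.
Qed.

Lemma sum_delta (f : D -> K) d : \sum_b f b * (b == d)%:R = f d.
Proof.
rewrite (bigD1 d) //= eqxx mulr1 big1 ?addr0 // => b /negPf ->.
by rewrite mulr0.
Qed.

Lemma sum_deltal (f : D -> K) d : \sum_b (d == b)%:R * f b = f d.
Proof.
rewrite (bigD1 d) //= eqxx mul1r big1 ?addr0 // => b /negPf h.
by rewrite eq_sym h mul0r.
Qed.

Lemma rho_one d e : rho mp2one d e = (d == e)%:R.
Proof.
have := rhoM valid_one valid_T d e; rewrite mp2_1mul; last exact: valid_T.
under eq_bigr => b _ do rewrite rhoT.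
rewrite (bigD1 e) //= eqxx big1 ?addr0 => [|b /negPf ->]; last by rewrite mulr0.
rewrite rhoT => h; apply: (mulIf (Qn0 e)); rewrite -h.
by case: eqP; rewrite ?mul1r ?mul0r.
Qed.

Lemma rho_mulV g : valid g -> forall d e,
  \sum_b rho g d b * rho (mp2inv g) b e = (d == e)%:R.
Proof.
by move=> vg d e; rewrite -rhoM ?mp2mulV ?rho_one //; apply: valid_inv.
Qed.

Lemma rho_inv_unique g (X : D -> D -> K) : valid g ->
  (forall d e, \sum_b X d b * rho g b e = (d == e)%:R) ->
  forall d e, rho (mp2inv g) d e = X d e.
Proof.
move=> vg hX d e; rewrite -(sum_delta (X d)).
under [RHS]eq_bigr => b _ do rewrite -(rho_mulV vg) mulr_sumr.
rewrite exchange_big /= -[LHS](sum_deltal (fun c => rho (mp2inv g) c e)).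
apply: eq_bigr => c _; rewrite -hX mulr_suml.
by apply: eq_bigr => b _; rewrite mulrA.
Qed.

(** Unitarity passes to products and inverses, so it is checked on T, where [Q] has modulus 1, and
    on S, by orthogonality of characters and [kappa_norm]. *)
Lemma rho_unitary g : valid g -> forall d e, rho (mp2inv g) d e = (rho g e d)^*.
Proof.
move=> vg; apply: (mp2_generated
  (P := fun g => forall d e, rho (mp2inv g) d e = (rho g e d)^*)) vg.
- apply: rho_inv_unique; first exact: valid_S.
  move=> d e; under eq_bigr => b _.
    rewrite !rhoS rmorphM fmorphV /= pair_conj invrK mulrACA -(pairNl hQ) -(pairDl hQ).
    rewrite (pairC hQ); over.
  rewrite -mulr_sumr (sum_pair hQ) natrM subr_eq0.
  by rewrite mulrA [_^* * _]mulrC kappa_norm mul1r.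
- apply: rho_inv_unique; first exact: valid_T.
  move=> d e; under eq_bigr => b _ do rewrite !rhoT.
  rewrite (bigD1 d) //= eqxx big1 ?addr0 => [|b /negPf ->]; last by rewrite rmorph0 mul0r.
  by rewrite Q_conj; case: eqP => [->|_]; rewrite ?mulr0 // mulVf.
- move=> g1 h vg' vh' hg hh d e; rewrite mp2invM // rhoM //; try exact: valid_inv.
  rewrite rhoM // rmorph_sum; apply: eq_bigr => b _.
  by rewrite hg hh rmorphM mulrC.
- by move=> g1 vg' hg d e; rewrite mp2invK // hg conjCK.
Qed.

Lemma pairMz x y (k : int) : B (x *~ k) y = B x y ^ k.
Proof.
case: k => k; first by rewrite -pmulrn (pairMnl hQ).
by rewrite NegzE mulrNz -pmulrn (pairNl hQ) (pairMnl hQ) -invr_expz.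
Qed.

Lemma pairMzr x y (k : int) : B x (y *~ k) = B x y ^ k.
Proof. by rewrite (pairC hQ) pairMz (pairC hQ). Qed.

Lemma quadMz x (k : int) : Q (x *~ k) = Q x ^ (k * k).
Proof.
case: k => k; first by rewrite -pmulrn (quadMn hQ) -mulnn.
rewrite NegzE mulrNz -pmulrn (quadN hQ) (quadMn hQ) mulrNN -mulnn.
by [].
Qed.

(* Conjugation by rho g of the Heisenberg operator
   e(x y q(u)) X_(x u) Z_(y u), in matrix entries. *)
Lemma rho_heisenberg g : valid g -> forall (u d e : D) (x y : int),
  let x' := md g * x + mc g * y in let y' := mb g * x + ma g * y in
  rho g d (e + u *~ x) * (Q u ^ (x * y) * B u e ^ y) =
  Q u ^ (x' * y') * B u (d - u *~ x') ^ y' * rho g (d - u *~ x') e.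
Proof.
move=> vg; apply: (mp2_generated (P := fun g => forall (u d e : D) (x y : int),
  let x' := md g * x + mc g * y in let y' := mb g * x + ma g * y in
  rho g d (e + u *~ x) * (Q u ^ (x * y) * B u e ^ y) =
  Q u ^ (x' * y') * B u (d - u *~ x') ^ y' * rho g (d - u *~ x') e)) vg.
- move=> u d e x y /=; rewrite !rhoS !mul0r !mul1r !addr0 !add0r mulN1r.
  rewrite (pairDl hQ) !(pairDr hQ) !(pairNr hQ) !pairMz !pairMzr (pair_diag hQ).
  rewrite (pairC hQ e u) !invfM !invrK.
  have hq := Qn0 u; have h1 := Bn0 u d; have h2 := Bn0 e d; have h3 := Bn0 u e.
  have -> : Q u ^ (x * y) = Q u ^ (y * - x) * Q u ^ (2 * (y * x)).
    by rewrite -expfzDr //; congr (_ ^ _); ring.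
  rewrite expfzMl exprz_inv !exprnP !exprz_exp opprK -invr_expz.
  rewrite -[Posz 2]/(2 : int).
  have h1x := expfz_neq0 x h1; have h3y := expfz_neq0 y h3.
  move: (_ ^ _) (Q u ^ (2 * _)) (B u d ^ x) h1x (B u e ^ y) h3y => A A' X hX Y hY.
  by field; rewrite h2 hX.
- move=> u d e x y /=; rewrite !rhoT !mul0r !mul1r addr0.
  rewrite -subr_eq; case: eqP => [<-|_]; last by rewrite mulr0 mul0r.
  rewrite subrK (_ : Q d = Q (d - u *~ x + u *~ x)); last by rewrite subrK.
  set e' := d - _; rewrite (quadD hQ) quadMz pairMzr (pairC hQ e') mulrDr !expfzDr //.
  by ring.
- move=> g1 g2 vg1 vg2 hg1 hg2 u d e x y /=; rewrite !rhoM // mulr_suml.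
  under eq_bigr => b _ do rewrite -mulrA hg2.
  rewrite mulr_sumr (reindex_inj (addIr (u *~ (md g2 * x + mc g2 * y)))) /=.
  apply: eq_bigr => b _; rewrite addrK mulrA hg1 mulrA.
  congr (Q u ^ (_ * _) * B u (d - u *~ _) ^ _ * rho g1 (d - u *~ _) b * _); ring.
- move=> g1 vg1 hg1 u d e x y /=; rewrite !rho_unitary //.
  set x' := _ * x + _; set y' := _ * x + _.
  have [dg _ _ _] := vg1.
  have hx : md g1 * x' + mc g1 * y' = x.
    by rewrite /x' /y' -[RHS]mul1r -dg; ring.
  have hy : mb g1 * x' + ma g1 * y' = y.
    by rewrite /x' /y' -[RHS]mul1r -dg; ring.
  (* At [x'], [y'] the transformation by [g1] gives back [x], [y], the determinant being 1.
     Conjugating this relation gives the one for the inverse, by unitarity. *)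
  have := hg1 u (e + u *~ x) (d - u *~ x') x' y'; rewrite /= hx hy subrK addrK.
  have cz (a : K) (k : int) : a^* = a^-1 -> (a ^ k)^* = (a ^ k)^-1.
    by move=> ha; rewrite fmorphXz /= ha exprz_inv invr_expz.
  move/(congr1 Num.conj); rewrite !rmorphM /= !(cz (Q u)) ?Q_conj // !(cz (B u _)) ?pair_conj //.
  have n1 := expfz_neq0 (x' * y') (Qn0 u); have n2 := expfz_neq0 (x * y) (Qn0 u).
  have n3 := expfz_neq0 y' (Bn0 u (d - u *~ x')); have n4 := expfz_neq0 y (Bn0 u e).
  move: (Q u ^ (x' * y')) (Q u ^ (x * y)) (B u (d - _) ^ _) (B u e ^ _) n1 n2 n3 n4.
  move: (_^*) (_^*) => r2 r1 q1 q2 b1 b2 n1 n2 n3 n4 h.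
  have r1E : r1 = q2^-1 * b2^-1 * r2 * (q1 * b1) by rewrite -h; field; rewrite n1 n3.
  by rewrite r1E; field; rewrite n2 n4.
Qed.

(** * The eigenvector e_0 and the frame operator *)

Section Gamma0.
Variable N : nat.
Hypothesis hN : forall x, Q x ^+ N = 1.

Lemma pair_level x y : B x y ^+ N = 1.
Proof.
by have := hN (x + y); rewrite (quadD hQ) !exprMn !hN !mul1r.
Qed.

(** As [N] divides [mc h], this entry kills [D]. The Heisenberg relation at [x = 0], [y = 1] then
    reads [rho h d 0 = B u d ^ ma h * rho h d 0]; since [ma h] is invertible modulo [N], a nonzero
    entry makes [d] orthogonal to all [u]. *)
Lemma rho_gamma0 h : gamma0 N h -> forall d, d != 0 -> rho h d 0 = 0.
Proof.
move=> [vh /dvdzP[q cq]] d d0; have [dh _ _ _] := vh.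
have Bz u v k : B u v ^ (k * N%:Z) = 1.
  by rewrite mulrC -exprz_exp -exprnP pair_level exp1rz.
have Qz u k : Q u ^ (k * N%:Z) = 1.
  by rewrite mulrC -exprz_exp -exprnP hN exp1rz.
have cu (u : D) : u *~ mc h = 0.
  by apply: (pair_nondeg hQ) => v; rewrite pairMz cq Bz.
apply/eqP/negPn/negP => r0.
have Ba u : B u d ^ ma h = 1.
  have := rho_heisenberg vh u d 0 0 1.
  rewrite /= mulr0z addr0 !mulr0 !mulr1 !add0r cu subr0 (pair0r hQ) expr0z exp1rz !mulr1.
  by rewrite cq [q * _ * _]mulrAC Qz mul1r => e; apply: (mulIf r0); rewrite -e mul1r.
case/eqP: d0; apply: (pair_nondeg hQ) => u; rewrite (pairC hQ).
rewrite -[LHS]expr1z -dh cq (_ : _ - _ = ma h * md h + (- (mb h * q)) * N%:Z); last by ring.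
by rewrite expfzDr // Bz mulr1 -exprz_exp Ba exp1rz.
Qed.

Lemma gamma0_inv h : gamma0 N h -> gamma0 N (mp2inv h).
Proof. by move=> [vh hc]; split; [exact: valid_inv | rewrite /= rpredN]. Qed.

Lemma rho_gamma0_row h : gamma0 N h -> forall d, d != 0 -> rho h 0 d = 0.
Proof.
move=> hh d d0; have := rho_gamma0 (gamma0_inv hh) d0.
rewrite rho_unitary; last by case: hh.
by move/eqP; rewrite fmorph_eq0 => /eqP.
Qed.

Lemma rho_gamma0_rowM h g : gamma0 N h -> valid g -> forall y,
  rho (mp2mul h g) 0 y = rho h 0 0 * rho g 0 y.
Proof.
move=> hh vg y; have [vh _] := hh; rewrite rhoM // (bigD1 0) //= big1 ?addr0 // => b b0.
by rewrite rho_gamma0_row // mul0r.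
Qed.

Lemma rho_gamma0_norm h : gamma0 N h -> rho (mp2inv h) 0 0 * rho h 0 0 = 1.
Proof.
move=> hh; have [vh _] := hh; have vi := valid_inv vh.
have := rho_gamma0_rowM (gamma0_inv hh) vh 0.
by rewrite mp2mulVg // rho_one eqxx => <-.
Qed.

(* Matrix of rho(g^-1) e_0 e_0^* rho(g). *)
Definition rank_one (g : mp2) (x y : D) : K := (rho g 0 x)^* * rho g 0 y.

Lemma rank_oneE g x y : valid g -> rank_one g x y = rho (mp2inv g) x 0 * rho g 0 y.
Proof. by move=> vg; rewrite rho_unitary. Qed.

(** The eigenvalue of [h] on e_0 has modulus 1 and cancels against its conjugate, so the operator
    depends only on the coset of [g]. *)
Lemma rank_one_gamma0 h g x y : gamma0 N h -> valid g ->
  rank_one (mp2mul h g) x y = rank_one g x y.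
Proof.
move=> hh vg; rewrite /rank_one !rho_gamma0_rowM // rmorphM /= mulrACA.
by have [vh _] := hh; rewrite -(rho_unitary vh) (rho_gamma0_norm hh) mul1r.
Qed.

Definition frame m (r : 'I_m -> mp2) (x y : D) : K := \sum_i rank_one (r i) x y.

(** Sending each representative to the index of its coset in the other system gives mutually inverse
    maps, and matched terms agree by [rank_one_gamma0]. *)
Lemma frame_indep m m' (r : 'I_m -> mp2) (r' : 'I_m' -> mp2) :
  coset_reps N r -> coset_reps N r' -> forall x y, frame r x y = frame r' x y.
Proof.
have match_ k k' (s : 'I_k -> mp2) (s' : 'I_k' -> mp2) : coset_reps N s -> coset_reps N s' ->
    exists f : 'I_k -> 'I_k', forall i, gamma0 N (mp2mul (s i) (mp2inv (s' (f i)))).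
  move=> [vs _] [_ us'].
  have [f hf] := @choice _ _ (fun i j => gamma0 N (mp2mul (s i) (mp2inv (s' j))))
    (fun i => let: ex_intro j (conj hj _) := us' _ (vs i) in ex_intro _ j hj).
  by exists f.
have sym g h : valid g -> valid h -> gamma0 N (mp2mul g (mp2inv h)) ->
    gamma0 N (mp2mul h (mp2inv g)).
  move=> vg vh /gamma0_inv; rewrite mp2invM ?mp2invK //; exact: valid_inv.
have canc k k' (s : 'I_k -> mp2) (s' : 'I_k' -> mp2) f f' : coset_reps N s -> coset_reps N s' ->
    (forall i, gamma0 N (mp2mul (s i) (mp2inv (s' (f i))))) ->
    (forall j, gamma0 N (mp2mul (s' j) (mp2inv (s (f' j))))) -> cancel f f'.
  move=> hs hs' hf hf' i; have [vs us] := hs; have [vs' _] := hs'.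
  have [j [_ uj]] := us _ (vs' (f i)).
  by rewrite -(uj _ (hf' (f i))) -(uj i) //; apply: sym (hf i).
move=> hr hr' x y; have [f hf] := match_ _ _ _ _ hr hr'; have [f' hf'] := match_ _ _ _ _ hr' hr.
have [vr _] := hr; have [vr' _] := hr'.
rewrite /frame (reindex f') /=; last first.
  by exists f => i _; [exact: (canc _ _ r' r f' f) | exact: (canc _ _ r r' f f')].
apply: eq_bigr => j _; rewrite -[in RHS](mp2mul1 (vr' j)) -(mp2mulVg (vr (f' j))).
rewrite mp2mulA ?rank_one_gamma0 //; try exact: valid_inv.
Qed.

Section Frame.
Variables (m : nat) (r : 'I_m -> mp2).
Hypothesis hr : coset_reps N r.

Lemma coset_reps_mul g : valid g -> coset_reps N (fun i => mp2mul (r i) g).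
Proof.
move=> vg; have [vr ur] := hr; split=> [i|g' vg']; first exact: valid_mul.
have vi := valid_inv vg; have [i [hi ui]] := ur _ (valid_mul vg' vi).
have E j : mp2mul g' (mp2inv (mp2mul (r j) g)) = mp2mul (mp2mul g' (mp2inv g)) (mp2inv (r j)).
  by rewrite mp2invM // mp2mulA //; apply: valid_inv.
by exists i; split=> [|j]; rewrite E //; apply: ui.
Qed.

(** Right translation by [g] gives another system of representatives, so [frame_indep] applies. *)
Lemma frame_comm g : valid g -> forall x y,
  \sum_z rho g x z * frame r z y = \sum_z frame r x z * rho g z y.
Proof.
move=> vg x y; have [vr _] := hr; have vi := valid_inv vg.
under eq_bigr => z _ do rewrite (frame_indep hr (coset_reps_mul vg)) mulr_sumr.
under [RHS]eq_bigr => z _ do rewrite mulr_suml.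
rewrite exchange_big [RHS]exchange_big; apply: eq_bigr => i _ /=.
have vri := vr i; have vrV := valid_inv vri.
under [RHS]eq_bigr => z _ do rewrite rank_oneE // -mulrA.
rewrite -mulr_sumr -rhoM //.
under eq_bigr => z _ do rewrite (rank_oneE _ _ (valid_mul vri vg)) mulrA.
rewrite -mulr_suml -rhoM //; last by apply/valid_inv/valid_mul.
rewrite mp2invM // mp2mulA // mp2mulV // mp2_1mul //.
Qed.

Lemma frame_conj x y : (frame r x y)^* = frame r y x.
Proof.
rewrite /frame rmorph_sum; apply: eq_bigr => i _.
by rewrite rmorphM /= conjCK mulrC.
Qed.

(** The frame operator commutes with the diagonal operator of T, whose eigenvalues are the norms. *)
Lemma frame_support x y : Q x != Q y -> frame r x y = 0.
Proof.
move=> hxy; have := frame_comm valid_T x y.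
under eq_bigr => z _ do rewrite rhoT.
under [RHS]eq_bigr => z _ do rewrite rhoT.
rewrite (bigD1 x) //= eqxx [X in _ + X]big1 => [|z zx]; last first.
  by rewrite eq_sym (negPf zx) mul0r.
rewrite addr0 (bigD1 y) //= eqxx [X in _ + X]big1 => [|z /negPf ->]; last by rewrite mulr0.
rewrite addr0 mulrC => /eqP; rewrite -subr_eq0 -mulrBr mulf_eq0 subr_eq0 (negPf hxy) orbF.
by move/eqP.
Qed.

(** The representative of the identity coset lies in the inverse image of Gamma_0(N), so its row of
    [A] is a nonzero multiple of the delta row. By [row_sub_gram] it is in the row space of the
    frame matrix. *)
Lemma frame_row_delta : exists lam : D -> K,
  forall y, \sum_x lam x * frame r x y = (y == 0)%:R.
Proof.
have [vr ur] := hr; have [i0 [hi0 _]] := ur _ valid_one.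
pose h := mp2inv (r i0).
have hh : gamma0 N h by move: hi0; rewrite mp2_1mul //; apply: valid_inv.
have ri : r i0 = mp2inv h by rewrite /h mp2invK.
pose A := \matrix_(i < m, j < #|D|) rho (r i) 0 (enum_val j).
have /submxP[v hv] : (row i0 A <= (map_mx Num.conj A)^T *m A)%MS.
  exact: submx_trans (row_sub i0 A) (row_sub_gram A).
have hM x y : ((map_mx Num.conj A)^T *m A) (enum_rank x) (enum_rank y) = frame r x y.
  by rewrite mxE; apply: eq_bigr => i _; rewrite !mxE !enum_rankK.
pose c := rho (r i0) 0 0.
have c0 : c != 0.
  apply: contraTneq (oner_neq0 K) => c0; rewrite -(rho_gamma0_norm hh) -ri -/c c0 mul0r.
  by rewrite eqxx.
exists (fun x => v 0 (enum_rank x) / c) => y.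
have := congr1 (fun u : 'rV[K]_#|D| => u 0 (enum_rank y)) hv; rewrite !mxE enum_rankK.
rewrite (reindex (enum_rank : D -> 'I_#|D|)) /=; last first.
  by apply: onW_bij; apply: enum_rank_bij.
under eq_bigr => x _ do rewrite hM.
move=> e; transitivity (c^-1 * rho (r i0) 0 y).
  by rewrite e mulr_sumr; apply: eq_bigr => x _; rewrite mulrA [c^-1 * _]mulrC.
have [->|y0] := eqVneq y 0; first by rewrite mulVf.
by rewrite ri rho_gamma0_row ?mulr0 //; apply: gamma0_inv.
Qed.

Definition frame_image (v : D -> K) : Prop :=
  exists w, forall x, v x = \sum_y frame r x y * w y.

Lemma frame_image_rho g v : valid g -> frame_image v ->
  frame_image (fun x => \sum_y rho g x y * v y).
Proof.
move=> vg [w hw]; exists (fun x => \sum_y rho g x y * w y) => x.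
under eq_bigr => y _ do rewrite hw mulr_sumr.
under [RHS]eq_bigr => y _ do rewrite mulr_sumr.
rewrite exchange_big [RHS]exchange_big; apply: eq_bigr => z _ /=.
under eq_bigr => y _ do rewrite mulrA.
under [RHS]eq_bigr => y _ do rewrite mulrA.
by rewrite -!mulr_suml frame_comm.
Qed.

Lemma frame_image_lin a v v' : frame_image v -> frame_image v' ->
  frame_image (fun x => a * v x + v' x).
Proof.
move=> [w hw] [w' hw']; exists (fun x => a * w x + w' x) => x.
rewrite hw hw' mulr_sumr -big_split; apply: eq_bigr => y _ /=.
by rewrite mulrDr mulrCA.
Qed.

Lemma frame_image_ext v v' : v =1 v' -> frame_image v -> frame_image v'.
Proof. by move=> e [w hw]; exists w => x; rewrite -e. Qed.

Lemma frame_image_scale a v : frame_image v -> frame_image (fun x => a * v x).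
Proof.
move=> [w hw]; exists (fun x => a * w x) => x.
by rewrite hw mulr_sumr; apply: eq_bigr => y _; rewrite mulrCA.
Qed.

Lemma kappa_neq0 : kappa != 0.
Proof.
by apply: contraTneq (oner_neq0 K) => k0; rewrite -kappa_norm k0 !mul0r eqxx.
Qed.

(** The operators of T, S and the inverse of S preserve the image of the frame; up to scalars they
    are multiplication by [Q] and the two Fourier transforms of [closure_invariant]. *)
Lemma frame_image_invariant (M : nat) : (0 < M)%N ->
  (forall p, prime p -> ~~ (p * p %| M)%N) -> (forall x : D, x *+ M = 0) ->
  forall F, quad_invariant Q F -> frame_image F.
Proof.
move=> M0 sqf kill F hF.
have k0 := kappa_neq0.
apply: (closure_invariant hQ M0 sqf kill frame_image_ext frame_image_lin) hF.
- move=> v /(frame_image_rho valid_T); apply: frame_image_ext => x.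
  under eq_bigr => y _ do rewrite rhoT.
  rewrite (bigD1 x) //= eqxx big1 ?addr0 // => y yx.
  by rewrite eq_sym (negPf yx) mul0r.
- move=> v /(frame_image_rho (valid_inv valid_S)) /(frame_image_scale (kappa^* )^-1).
  apply: frame_image_ext => x; rewrite mulr_sumr; apply: eq_bigr => y _.
  rewrite rho_unitary; last exact: valid_S.
  rewrite rhoS rmorphM fmorphV /= pair_conj invrK mulrA mulKf ?fmorph_eq0 //.
  by rewrite (pairC hQ).
- move=> v /(frame_image_rho valid_S) /(frame_image_scale kappa^-1).
  apply: frame_image_ext => x; rewrite mulr_sumr; apply: eq_bigr => y _.
  by rewrite rhoS mulrA mulKf.
(* The frame matrix is Hermitian, so conjugating the functional that gives the delta row yields a
   preimage of the delta column. *)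
- have [lam hl] := frame_row_delta; exists (fun x => (lam x)^*) => x.
  rewrite -(rmorph_nat Num.conj) -hl rmorph_sum; apply: eq_bigr => y _.
  by rewrite rmorphM /= frame_conj mulrC.
Qed.

(** Restricting [lam] to norm 1 is harmless: by [frame_support] the discarded entries meet only
    columns of norm other than 1, where the delta function is 0. *)
Lemma frame_isotropic_row : exists lam : D -> K,
  (forall x, Q x != 1 -> lam x = 0) /\
  forall y, \sum_x lam x * frame r x y = (y == 0)%:R.
Proof.
have [lam hl] := frame_row_delta.
exists (fun x => if Q x == 1 then lam x else 0); split=> [x /negPf -> //|y].
have [hy|hy] := eqVneq (Q y) 1.
  rewrite -hl; apply: eq_bigr => x _; case: eqP => // /eqP hx.
  by rewrite frame_support ?mulr0 ?mul0r // hy.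
rewrite big1 => [|x _]; last first.
  case: eqP => [hx|_]; last by rewrite mul0r.
  by rewrite frame_support ?mulr0 // hx eq_sym.
by have [y0|//] := eqVneq y 0; rewrite y0 (quad0 hQ) eqxx in hy.
Qed.

End Frame.

(* lam inverts the frame operator S of V = span of the orbit of e_0:
   lam S = e_0^*; as S commutes with rho, a vector F = S w of V is recovered
   from the scalars lam (rho g F) = (rho g w)_0. *)
Lemma isotropic_reconstruction (M : nat) m (r : 'I_m -> mp2) : (0 < M)%N ->
  (forall p, prime p -> ~~ (p * p %| M)%N) -> (forall x : D, x *+ M = 0) ->
  coset_reps N r ->
  exists lam : D -> K, (forall x, Q x != 1 -> lam x = 0) /\
    forall F, quad_invariant Q F ->
      (forall h, gamma0 N h -> \sum_x lam x * (\sum_y rho h x y * F y) =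
         rho h 0 0 * \sum_x lam x * F x) /\
      (forall m' (r' : 'I_m' -> mp2), coset_reps N r' -> forall x,
         F x = \sum_i (\sum_y lam y * (\sum_z rho (r' i) y z * F z)) *
           rho (mp2inv (r' i)) x 0).
Proof.
move=> M0 sqf kill hr; have [lam [lam0 hl]] := frame_isotropic_row hr.
exists lam; split=> // F /(frame_image_invariant hr M0 sqf kill) [w hw].
have lamS u : \sum_x lam x * (\sum_y frame r x y * u y) = u 0.
  under eq_bigr => x _ do rewrite mulr_sumr.
  rewrite exchange_big /= -[RHS](sum_deltal u); apply: eq_bigr => y _.
  rewrite eq_sym -hl mulr_suml; apply: eq_bigr => x _; exact: mulrA.
have lamF g : valid g ->
    \sum_x lam x * (\sum_y rho g x y * F y) = \sum_z rho g 0 z * w z.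
  move=> vg; rewrite -[RHS](lamS (fun x => \sum_z rho g x z * w z)).
  apply: eq_bigr => x _; congr (_ * _).
  under eq_bigr => y _ do rewrite hw mulr_sumr.
  under [RHS]eq_bigr => y _ do rewrite mulr_sumr.
  rewrite exchange_big [RHS]exchange_big; apply: eq_bigr => z _ /=.
  under eq_bigr => y _ do rewrite mulrA.
  under [RHS]eq_bigr => y _ do rewrite mulrA.
  by rewrite -!mulr_suml frame_comm.
split=> [h hh|m' r' hr' x].
  have [vh _] := hh; rewrite lamF // (bigD1 0) //= big1 ?addr0 => [|z z0]; last first.
    by rewrite rho_gamma0_row // mul0r.
  congr (_ * _); rewrite -[LHS]lamS; apply: eq_bigr => y _; by rewrite hw.
have [vr' _] := hr'.
rewrite hw; under eq_bigr => y _ do rewrite (frame_indep hr hr') mulr_suml.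
rewrite exchange_big; apply: eq_bigr => i _ /=; rewrite lamF // mulr_suml.
by apply: eq_bigr => y _; rewrite rank_oneE // -mulrA mulrC.
Qed.

End Gamma0.
End WeilRepresentation.

(** * Return to lattices and modular forms *)

Lemma real_complex_sqrt_nat (k : nat) :
  ((Num.sqrt (k%:R : Rr))%:C)%C * ((Num.sqrt (k%:R : Rr))%:C)%C = k%:R :> Rr[i].
Proof. by rewrite -rmorphM /= -expr2 sqr_sqrtr ?ler0n // rmorph_nat. Qed.

Lemma weil_scalar_norm (x : rat) (k : nat) : (0 < k)%N ->
  let kappa : Rr[i] := eC x / ((Num.sqrt (k%:R : Rr))%:C)%C in
  kappa * kappa^* * k%:R = 1.
Proof.
move=> k0 /=; set s : Rr[i] := (_%:C)%C.
have ss : s * s = k%:R by apply: real_complex_sqrt_nat.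
have s0 : s != 0.
  by apply/eqP => e; move/eqP: ss; rewrite e mul0r eq_sym pnatr_eq0 gtn_eqF.
have sJ : s^* = s by apply: conjc_real.
have eJ : (eC x : Rr[i])^* = (eC x : Rr[i])^-1 by rewrite -[LHS]/((eC x : Rr[i])^*)%C eC_conj eCN.
rewrite fmorph_div /= sJ eJ -ss; have e0 : (eC x : Rr[i]) != 0 := eC_neq0 x.
by field; rewrite e0 s0.
Qed.

Theorem mainTheorem13
  (n : nat) (G : 'M[int]_n) (bp bm N : nat) (k2 : int)
  (rho : mp2 -> Disc G -> Disc G -> C) (F : C -> Disc G -> C) :
  even_lattice G -> signature G bp bm -> elementary G -> level G N ->
  weil_rep bp bm rho ->
  (forall d, holoH (fun t => F t d)) ->
  (forall s, autD s -> forall t, upper t -> forall d, F t (s d) = F t d) ->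
  (forall g, valid g -> forall t, upper t -> forall d,
     F (act g t) d = mphi g t ^ k2 * applyR (rho g) (F t) d) ->
  exists (f : C -> C) (lam : Disc G -> C),
    [/\ (forall d, ~~ is_int (qD d) -> lam d = 0),
        (forall t, upper t -> f t = \sum_d lam d * F t d),
        (forall h, gamma0 N h -> forall t, upper t ->
           slash k2 f h t = chiL rho h * f t) &
        (forall (m : nat) (r : 'I_m -> mp2), coset_reps N r ->
           forall t, upper t -> forall d,
             F t d = \sum_i slash k2 f (r i) t * applyR (rho (mp2inv (r i))) (@e0 n G) d)].
Proof.
move=> evenG _ [M [M0 sqf torM]] lev [rhoM rhoT rhoS] _ Faut Fmod.
(* One system of representatives fixes [lam], which then serves for every other system. If there is
   none, the expansion is vacuous and zero satisfies the rest. *)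
have [[m [r hr]]|nreps] := pselect (exists m (r : 'I_m -> mp2), coset_reps N r); last first.
  exists (fun=> 0), (fun=> 0); split=> //.
  - by move=> t _; rewrite big1 // => d _; rewrite mul0r.
  - by move=> h _ t _; rewrite /slash !mulr0.
  - by move=> m r hr; case: nreps; exists m, r.
pose D := discz (dG_gt0 evenG) : finZmodType.
have hQ := disc_quadratic_module evenG.
have QJ (x : D) : (dq (evenG := evenG) x)^* = (dq (evenG := evenG) x)^-1.
  by rewrite -[LHS]/((eC (qD x) : Rr[i])^*)%C eC_conj eCN.
pose rho' : mp2 -> D -> D -> Rr[i] := rho.
pose kappa : Rr[i] := eC (- ((bp%:Z - bm%:Z)%:~R / 8)) / ((Num.sqrt (#|{: Disc G}|%:R : Rr))%:C)%C.
have kappa1 : kappa * kappa^* * #|D|%:R = 1.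
  by apply: weil_scalar_norm; apply/card_gt0P; exists (0 : D).
have rT (d e : D) : rho' mp2T d e = if d == e then dq e else 0.
  by apply: rhoT; [exact: valid_T | | | | | move=> t ht /=; rewrite asboolT].
have rS (d e : D) : rho' mp2S d e = kappa * (db e d)^-1.
  rewrite /rho' rhoS //; [|exact: valid_S|exact: Re_upper_sqrt].
  by rewrite eCN.
have lev' (x : D) : dq x ^+ N = 1 by apply: level_torsion.
have kill (x : D) : x *+ M = 0 by apply: elementary_torsion.
have e0E (d : D) : e0 d = (d == 0)%:R :> Rr[i].
  by rewrite /e0 isZeroDE; case: eqP.
have apply_e0 g (d : D) : applyR (rho g) (@e0 n G) d = rho' g d 0.
  by rewrite -[RHS](sum_delta (rho' g d)); apply: eq_bigr => b _; rewrite e0E.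
have chiE h : chiL rho h = rho' h 0 0.
  rewrite -[RHS](sum_deltal (fun d => rho' h d 0)); apply: eq_bigr => d _.
  by rewrite apply_e0 e0E eq_sym.
have [lam [lam0 hlam]] := isotropic_reconstruction hQ QJ kappa1 rhoM rT rS lev' M0 sqf kill hr.
(* Additive maps preserving [dq] are bijective and preserve [qD] modulo 1, so they are the
   automorphisms of [autD]. *)
have Finv t : upper t -> quad_invariant (dq (evenG := evenG)) (F t).
  move=> ht s sD sQ; apply: Faut ht; split.
  - exact: injF_bij (isometry_inj hQ sD sQ).
  - move=> x y z; have E := @addDE n G evenG.
    by rewrite !E => /eqP <-; rewrite sD.
  - by move=> x; apply: eC_eq; apply: sQ.
exists (fun t => \sum_d lam d * F t d), lam.
have slashE g t : valid g -> upper t ->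
    slash k2 (fun t => \sum_d lam d * F t d) g t =
    \sum_(x : D) lam x * (\sum_(y : D) rho' g x y * F t y).
  move=> vg ht; rewrite /slash mulr_sumr; apply: eq_bigr => d _.
  (* The weight factor in the transformation law of [F] cancels the one in the slash operator. *)
  rewrite Fmod // mulrCA [X in _ * X]mulrA -expfzDr ?mphi_neq0 // addNr expr0z mul1r.
  by [].
split=> //.
- move=> d hd; apply: lam0; apply: contraNneq hd; exact: eC_eq1.
- move=> h hh t ht; have [vh _] := hh.
  rewrite slashE // chiE; exact: (hlam _ (Finv t ht)).1.
- move=> m' r' hr' t ht d; have [vr' _] := hr'.
  rewrite [LHS]((hlam _ (Finv t ht)).2 m' r' hr').
  by apply: eq_bigr => i _; rewrite slashE // apply_e0.
Qed.
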